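(* Let $G=SL(n,\mathbb C)$, $2\le r\le n-2$, and let $P_r$ be the maximal parabolic subgroup associated to the simple root $\alpha_r$, so that $G/P_r=Gr(r,n)$, with line bundle $\mathcal L_r=\mathcal L_{\omega_r}$. Let $v=(v_1,\dots,v_r)\in W^{P_r}$ be the unique minimal element with $X_{P_r}(v)^{ss}_T(\mathcal L_r)\ne\emptyset$. Let $w=(w_1,\dots,w_r)\in W^{P_r}$ be such that $X_{P_r}(w)^{ss}_T(\mathcal L_r)$ is nonempty. Then the semistable locus $X_{P_r}(w)^{ss}_T(\mathcal L_r)$ is contained in the smooth locus of $X_{P_r}(w)$ if and only if, for every $1\le i\le r-1$, $w_i<v_{i+1}$ whenever $w_{i+1}>w_i+1$.
   Context: $T\subset B\subset P_r$ are a maximal torus and a Borel subgroup. $W^{P_r}$, the set of minimal length representatives of $S_n/(S_r\times S_{n-r})$, is identified with the set of sequences $(i_1,\dots,i_r)$ with $1\le i_1<\dots<i_r\le n$ by $w\mapsto (w(1),\dots,w(r))$; the Bruhat order is the componentwise order. $X_{P_r}(w)=\overline{BwP_r/P_r}$ is the Schubert variety. $\mathcal L_r$ is the ample homogeneous (Plücker) line bundle on $Gr(r,n)$ associated to the fundamental weight $\omega_r$ with its natural $SL(n,\mathbb C)$-linearization. $X_{P_r}(w)^{ss}_T(\mathcal L_r)$ is the set of points $x\in X_{P_r}(w)$ at which some $T$-invariant section of some power $\mathcal L_r^m$, $m\ge1$, on $X_{P_r}(w)$ does not vanish. It is known that there is a unique minimal $v\in W^{P_r}$ (for the Bruhat order)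 with $X_{P_r}(v)^{ss}_T(\mathcal L_r)\neq\emptyset$. *)

(* Defs.v *)
From mathcomp Require Import all_boot all_order all_algebra.
From mathcomp Require Import mpoly.
From mathcomp Require Import classical_sets.

Set Implicit Arguments.
Unset Strict Implicit.
Unset Printing Implicit Defensive.

Import GRing.Theory.
Local Open Scope ring_scope.
Local Open Scope classical_set_scope.

(* A point of P^(N-1)(K) is given by its nonzero vectors of homogeneous
   coordinates.  A subset of P^(N-1) is the set of all nonzero vectors
   representing its points: it omits 0 and is stable under nonzero scalars. *)
Section ProjectiveVarieties.
Variables (K : fieldType) (N : nat).
Implicit Types (X Y Z : set 'rV[K]_N) (x y : 'rV[K]_N) (f g : {mpoly K[N]}).

Definition vanishes_on X f : Prop := forall x, X x -> f.@[x 0] = 0.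

Definition zariski_closure X : set 'rV[K]_N :=
  [set x : 'rV[K]_N | x != 0 /\
    forall d f, f \is d.-homog -> vanishes_on X f -> f.@[x 0] = 0].

(* This equality also forces Z to omit 0 and to be stable under scaling. *)
Definition zariski_closed Z : Prop := zariski_closure Z = Z.

Definition irreducible_closed Z : Prop :=
  [/\ zariski_closed Z, Z !=set0 &
      forall Y1 Y2, zariski_closed Y1 -> zariski_closed Y2 ->
        Z `<=` Y1 `|` Y2 -> Z `<=` Y1 \/ Z `<=` Y2].

Definition irreducible_chain X (d : nat) : Prop :=
  exists Z : nat -> set 'rV[K]_N,
    (forall i, (i <= d)%N -> irreducible_closed (Z i) /\ Z i `<=` X) /\
    (forall i, (i < d)%N -> Z i `<` Z i.+1).

(* X, closed in P^(N-1), has Krull dimension d. *)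
Definition has_dim X (d : nat) : Prop :=
  irreducible_chain X d /\ forall e, irreducible_chain X e -> (e <= d)%N.

(* The linear subspace of K^N whose projectivization is the projective tangent
   space to X (with its reduced structure) at x. Its dimension is one more than
   that of the Zariski tangent space, since it contains the line through x. *)
Definition tangent_cone_space X x : set 'rV[K]_N :=
  [set y : 'rV[K]_N | forall d f, f \is d.-homog -> vanishes_on X f ->
    \sum_(i < N) (mderiv i f).@[x 0] * y 0 i = 0].

(* For X irreducible, so that the dimension of X is its dimension at x. *)
Definition smooth_locus X : set 'rV[K]_N :=
  [set x | X x /\ exists (d : nat) (U : {vspace 'rV[K]_N}),
    [/\ has_dim X d, tangent_cone_space X x = [set y | y \in U]
      & \dim U = d.+1]].

(* Global sections of O(m) restricted to the closed subvariety X, as functions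
   on the punctured affine cone over X: near each point, s is a quotient of
   homogeneous polynomials whose degrees differ by m. *)
Definition is_section X (m : nat) (s : 'rV[K]_N -> K) : Prop :=
  forall x, X x -> exists (d : nat) (f g : {mpoly K[N]}),
    [/\ f \is (d + m).-homog, g \is d.-homog, g.@[x 0] != 0 &
        forall y, X y -> g.@[y 0] != 0 -> s y = f.@[y 0] / g.@[y 0]].

End ProjectiveVarieties.

(* W^{P_r}; entries are numbered from 0 instead of 1, both for the positions
   and for the values. *)
Definition minrep (r n : nat) : Type :=
  {w : {ffun 'I_r -> 'I_n} |
    [forall i : 'I_r, forall j : 'I_r, (i < j)%N ==> (w i < w j)%N]}.

Definition minrep_fun r n (w : minrep r n) : 'I_r -> 'I_n := val w.
Coercion minrep_fun : minrep >-> Funclass.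

Definition bruhat_le r n (u w : minrep r n) : Prop :=
  forall i : 'I_r, (u i <= w i)%N.

(* Gr(r,n) = G/P_r is identified with the G-orbit of [e_1 /\ ... /\ e_r] in
   P(Lambda^r K^n), where Lambda^r K^n has coordinates indexed by minrep r n
   (the Plucker coordinates), so that L_r is the restriction of O(1). *)
Section Schubert.
Variables (K : fieldType) (r n : nat).

(* e_(w 1) /\ ... /\ e_(w r), which represents the point wP_r of G/P_r. *)
Definition wedge_basis (w : minrep r n) : 'rV[K]_#|{: minrep r n}| :=
  delta_mx 0 (enum_rank w).

(* Lambda^r g, whose matrix consists of the r x r minors of g. *)
Definition wedge_act (g : 'M[K]_n) (x : 'rV[K]_#|{: minrep r n}|) :
    'rV[K]_#|{: minrep r n}| :=
  \row_i \sum_j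
    \det (mxsub (enum_val i : minrep r n) (enum_val j : minrep r n) g) * x 0 j.

Definition torus : set 'M[K]_n := [set t | is_diag_mx t /\ \det t = 1].

(* Upper triangular matrices; is_trig_mx means lower triangular. *)
Definition borel : set 'M[K]_n := [set b | is_trig_mx b^T /\ \det b = 1].

Definition schubert_cell (w : minrep r n) : set 'rV[K]_#|{: minrep r n}| :=
  [set x | exists (b : 'M[K]_n) (c : K),
    [/\ borel b, c != 0 & x = c *: wedge_act b (wedge_basis w)]].

(* Gr(r,n) is closed in P(Lambda^r K^n), so the closure can be taken there. *)
Definition schubert (w : minrep r n) : set 'rV[K]_#|{: minrep r n}| :=
  zariski_closure (schubert_cell w).

(* T acts on sections of L_r^m through its linear action on Lambda^r K^n. *)
Definition T_invariant (X : set 'rV[K]_#|{: minrep r n}|)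
    (s : 'rV[K]_#|{: minrep r n}| -> K) : Prop :=
  forall t x, torus t -> X x -> s (wedge_act t x) = s x.

Definition semistable (w : minrep r n) : set 'rV[K]_#|{: minrep r n}| :=
  [set x | schubert w x /\ exists (m : nat) (s : 'rV[K]_#|{: minrep r n}| -> K),
    [/\ (0 < m)%N, is_section (schubert w) m s, T_invariant (schubert w) s
      & s x != 0]].

Definition minimal_semistable (v : minrep r n) : Prop :=
  semistable v !=set0 /\
  forall u, bruhat_le u v -> semistable u !=set0 -> u = v.

End Schubert.

Arguments wedge_basis K {r n} w.
Arguments schubert_cell K {r n} w.
Arguments schubert K {r n} w.
Arguments semistable K {r n} w.
Arguments minimal_semistable K {r n} v.

(* Main.v *)
(* A point [x] of [X(w)] lies in a unique cell [u <= w], and Borel symmetry moves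
   the tangent space at [x] to the one at the torus fixed point [e_u].  There the
   Plucker relations leave exactly the coordinates [t <= w] obtained from [u] by
   exchanging at most one entry.  For a fixed entry [u_i] the number of admissible
   exchanges is [w_k - k], where [k >= i] is least with [k = r] or [w_k < u_(k+1)];
   since [w_k - k >= w_i - i] and [dim X(w) = sum_i (w_i - i)], the point [x] is
   smooth iff [w_i < u_(i+1)] whenever [w_i + 1 < w_(i+1)].
     If [x] is semistable in [X(w)], it is so in [X(u)], hence [v <= u], which gives
   one implication.  For the other, a one-parameter subgroup shows [v0 <= v] for
   [v0_i = ceil(i n / r)], while the columns of a rectangular tableau give a
   torus-invariant monomial in the Plucker coordinates that does not vanish on
   [X(v0)]: so [X(v0)] contains a point semistable in [X(w)], and this point is
   singular as soon as [v_(i+1) <= w_i] and [w_i + 1 < w_(i+1)] for some [i]. *)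
Require Import Defs.
From mathcomp Require Import all_boot all_order all_algebra.
From mathcomp Require Import fingroup perm mpoly zify ring.
From mathcomp Require Import boolp classical_sets reals.
From mathcomp Require Import complex.

Set Implicit Arguments.
Unset Strict Implicit.
Unset Printing Implicit Defensive.

Import GRing.Theory Num.Theory.

(** * Minimal representatives *)

Section Minrep.
Variables r n : nat.
Implicit Types (u v w t : minrep r n) (i j k l : 'I_r) (f : 'I_r -> 'I_n).

(** Dimension means length of chains of irreducible closed sets, so the count of tangent directions
    has to be compared with chains. Below, the Schubert varieties themselves form a chain of the
    right length. Above, growth of forms replaces a Hilbert polynomial: each strict step of a chain
    gains a factor [m] in the number of independent forms of degree O(m), while forms pulled back to
    a cell with [l] parameters span only O(m^l) dimensions. Plucker coordinates are taken on
    arbitrary sequences, with signs, so that the relations need no sorting; the Bruhat order is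
    tested by counting entries below a bound, which ignores order. The bound ceil(i n / r) comes
    from the one-parameter subgroups that separate the first q basis vectors from the rest: on a
    coordinate with c entries among those q the weight is n c - r q. For q = v_i every coordinate on
    X(v) has c >= i, so n i > r v_i would make all weights positive. *)

Lemma minrep_lt w i j : i < j -> w i < w j.
Proof. by move=> ij; have /forallP/(_ i)/forallP/(_ j)/implyP := valP w; exact. Qed.

Lemma minrep_leE w i j : (w i <= w j) = (i <= j).
Proof.
case: (ltngtP i j) => [ij|ij|/val_inj ->]; last by rewrite leqnn.
- by rewrite ltnW ?minrep_lt.
- by apply/negbTE; rewrite -ltnNge minrep_lt.
Qed.

Lemma minrep_ltE w i j : (w i < w j) = (i < j).
Proof. by rewrite !ltnNge minrep_leE. Qed.

Lemma minrep_inj w : injective w.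
Proof. by move=> i j e; apply/val_inj/eqP; rewrite eqn_leq -!(minrep_leE w) e leqnn. Qed.

Lemma minrep_eq u v : u =1 v -> u = v.
Proof. by move=> e; apply/val_inj/ffunP => i; apply: e. Qed.

Lemma minrep_of f : {homo f : i j / i < j >-> i < j} -> {w : minrep r n | w =1 f}.
Proof.
move=> fi.
have H : [forall i : 'I_r, forall j : 'I_r, (i < j) ==> (finfun f i < finfun f j)].
  by apply/forallP => i; apply/forallP => j; apply/implyP; rewrite !ffunE; apply: fi.
by exists (exist _ (finfun f) H) => i; rewrite /minrep_fun /= ffunE.
Qed.

Lemma minrep_ge_sub w (i j : 'I_r) : i <= j -> w i - i <= w j - j.
Proof.
case: j => j; elim: j => [|j IHj] ltj /= ij.
  by rewrite (_ : i = Ordinal ltj) //; apply: val_inj => /=; lia.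
move: ij; rewrite leq_eqVlt => /predU1P[e|ij].
  by rewrite (_ : i = Ordinal ltj) //; apply: val_inj.
have /= := IHj (ltnW ltj) ij.
have /= := @minrep_lt w (Ordinal (ltnW ltj)) (Ordinal ltj) (ltnSn _).
lia.
Qed.

Lemma minrep_ge w i : i <= w i.
Proof.
case: i => i; elim: i => [//|i IHi] lti.
apply: leq_ltn_trans (IHi (ltnW lti)) _.
exact: minrep_lt.
Qed.

Definition brle u w := [forall i, u i <= w i].

Lemma brleP u w : reflect (bruhat_le u w) (brle u w).
Proof. exact: forallP. Qed.

Lemma brle_refl u : brle u u.
Proof. by apply/forallP => i. Qed.

Lemma brle_trans v u w : brle u v -> brle v w -> brle u w.
Proof.
by move=> /forallP uv /forallP vw; apply/forallP => i; apply: leq_trans (uv i) (vw i).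
Qed.

Lemma brle_anti u w : brle u w -> brle w u -> u = w.
Proof.
move=> /forallP uw /forallP wu; apply: minrep_eq => i; apply/val_inj/eqP.
by rewrite eqn_leq uw wu.
Qed.

(** Insensitive to the order of the values of [f], which makes the Bruhat order testable on
    sequences that have not been sorted. *)
Definition count_le f (k : nat) := #|[set i | f i <= k]|.

Lemma card_ord_le (m : nat) (l : 'I_m) : #|[set i : 'I_m | i <= l]| = l.+1.
Proof.
have -> : [set i : 'I_m | i <= l] = [set widen_ord (ltn_ord l) i | i : 'I_l.+1].
  apply/setP => i; rewrite inE; apply/idP/imsetP => [il|[j _ ->]] /=.
    by exists (Ordinal (il : i < l.+1)) => //; apply: val_inj.
  by rewrite -ltnS.
by rewrite card_imset ?card_ord // => i j /(congr1 val) /= e; apply: val_inj.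
Qed.

Lemma card_ord_lt l : #|[set i : 'I_r | i < l]| = l.
Proof.
have /eqP := card_ord_le l; rewrite (cardsD1 l) inE leqnn add1n eqSS => /eqP e; rewrite -[RHS]e.
by apply: eq_card => i; rewrite !inE ltn_neqAle -val_eqE.
Qed.

(** The entries of [u] increase, so those at most [k] form an initial segment, which contains [l]
    exactly when its size exceeds [l]. *)
Lemma count_le_ltE u l (k : nat) : (l < count_le u k) = (u l <= k).
Proof.
case: (leqP (u l) k) => ulk.
  rewrite -(card_ord_le l) /count_le.
  apply/subset_leq_card/fintype.subsetP => i; rewrite !inE => il.
  by apply: leq_trans ulk; rewrite minrep_leE.
apply/negbTE; rewrite -leqNgt -[X in _ <= X]card_ord_lt /count_le.
apply/subset_leq_card/fintype.subsetP => i; rewrite !inE => uik.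
by rewrite -(minrep_ltE u); apply: leq_ltn_trans ulk.
Qed.

Lemma brle_count u w : brle u w = [forall l : 'I_r, l < count_le u (w l)].
Proof. by apply: eq_forallb => l; rewrite count_le_ltE. Qed.

Lemma count_le_perm f (s : 'S_r) (k : nat) : count_le (f \o s) k = count_le f k.
Proof.
rewrite /count_le -(card_imset _ (@perm_inj _ s)); apply: eq_card => i; rewrite inE.
apply/imsetP/idP => [[j + ->]|fik]; first by rewrite inE.
by exists (s^-1%g i); rewrite ?inE /= permKV.
Qed.

(** Domination along any pairing of the entries passes to the counts, and the counts determine the
    order. *)
Lemma brle_perm u w (s : 'S_r) : (forall i, u i <= w (s i)) -> brle u w.
Proof.
move=> h; rewrite brle_count; apply/forallP => l.
apply: leq_trans (_ : count_le (w \o s) (w l) <= _).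
  by rewrite count_le_perm count_le_ltE.
by rewrite /count_le; apply/subset_leq_card/fintype.subsetP => i; rewrite !inE /=; apply: leq_trans.
Qed.

(** [t] lists the image of [f]: the [enum] of a set of ordinals is a subsequence of 0, ..., n - 1,
    hence already increasing. *)
Lemma sorted_rearrangement f : injective f ->
  exists t (s : 'S_r), f =1 t \o s.
Proof.
move=> f_inj; pose A := [set f i | i : 'I_r].
have szA : size (enum A) = r by rewrite -cardE card_imset ?card_ord.
have srt : sorted ltn (map val (enum A)).
  have := iota_ltn_sorted 0 n.
  rewrite -val_enum_ord enumT [enum A]/(filter _ _).
  apply: subseq_sorted; first exact: ltn_trans.
  by apply: map_subseq; apply: filter_subseq.
case: (posnP r) => [r0|r_gt0].
  have h0 : forall i : 'I_r, False by case=> i; rewrite r0.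
  have [t _] := @minrep_of f (fun i => False_ind _ (h0 i)).
  by exists t, 1%g => i; case: (h0 i).
pose x0 := f (Ordinal r_gt0).
have [t tE] : {t : minrep r n | t =1 fun i => nth x0 (enum A) i}.
  apply: minrep_of => i j ij.
  have H := sorted_ltn_nth ltn_trans 0 srt; have := H i j.
  by rewrite !inE !size_map !szA !(nth_map x0) ?szA //; apply.
have fA i : f i \in enum A by rewrite mem_enum; apply/imsetP; exists i.
have idx i : index (f i) (enum A) < r by rewrite -szA index_mem.
have s_inj : injective (fun i => Ordinal (idx i)).
  move=> i j /(congr1 val) /= /(congr1 (nth x0 (enum A))).
  by rewrite !nth_index //; apply: f_inj.
exists t, (perm s_inj) => i /=.
by rewrite tE permE /= nth_index.
Qed.

Lemma rearrangement_uniq t t' (s s' : 'S_r) : t \o s =1 t' \o s' -> t = t'.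
Proof.
move=> e; apply: brle_anti.
  apply: (@brle_perm _ _ (s^-1 * s')%g) => i.
  by rewrite permM; have /= <- := e (s^-1%g i); rewrite permKV.
apply: (@brle_perm _ _ (s'^-1 * s)%g) => i.
by rewrite permM; have /= -> := e (s'^-1%g i); rewrite permKV.
Qed.

(** * Exchanging one entry, and counting the exchanges that stay below [w] *)

Definition replace (T : Type) (f : 'I_r -> T) i (x : T) : 'I_r -> T :=
  fun k => if k == i then x else f k.

Lemma replace_id (T : Type) (f : 'I_r -> T) i : replace f i (f i) =1 f.
Proof. by move=> k; rewrite /replace; case: eqP => // ->. Qed.

Lemma replace_inj u i (x : 'I_n) : x \notin codom u -> injective (replace u i x).
Proof.
move=> xu k l; rewrite /replace; case: eqP => [->|ki]; case: eqP => [->|li] //.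
- by move=> e; case/negP: xu; rewrite e codom_f.
- by move=> e; case/negP: xu; rewrite -e codom_f.
- exact: minrep_inj.
Qed.

(* Junk value [u] unless the values of [f] are distinct. *)
Definition sort_fun u f : minrep r n :=
  odflt u [pick t : minrep r n | [exists s : 'S_r, [forall i, f i == t (s i)]]].

Lemma sort_funP u f : injective f -> exists s : 'S_r, f =1 sort_fun u f \o s.
Proof.
move=> f_inj; rewrite /sort_fun; case: pickP => /= [t /existsP[s /forallP h]|h].
  by exists s => i; apply/eqP; apply: h.
have [t [s ts]] := sorted_rearrangement f_inj; have := h t.
by move/negbT/existsP; case; exists s; apply/forallP => i; apply/eqP; apply: ts.
Qed.

Definition exchange u i x := sort_fun u (replace u i x).

Lemma exchangeP u i x : x \notin codom u ->
  exists s : 'S_r, replace u i x =1 exchange u i x \o s.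
Proof. by move=> xu; apply: sort_funP; apply: replace_inj. Qed.

Lemma codom_exchange u i x y : x \notin codom u ->
  (y \in codom (exchange u i x)) = (y == x) || (y \in codom u) && (y != u i).
Proof.
move=> xu; have [s se] := exchangeP i xu.
have -> : (y \in codom (exchange u i x)) = (y \in codom (replace u i x)).
  apply/codomP/codomP => [[k ->]|[k ->]].
    by exists (s^-1%g k); rewrite se /= permKV.
  by exists (s k); apply: se.
apply/codomP/orP => [[k ->]|[/eqP->|/andP[/codomP[k ->]]]].
- rewrite /replace; case: (eqVneq k i) => [_|ki]; first by left.
  by right; rewrite codom_f (inj_eq (@minrep_inj u)).
- by exists i; rewrite /replace eqxx.
- by rewrite (inj_eq (@minrep_inj u)) => ki; exists k; rewrite /replace (negbTE ki).
Qed.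

(** The pair is read off from the set of values: [x] is the only value gained and [u i] the only one
    lost. *)
Lemma exchange_inj u i j x y : x \notin codom u -> y \notin codom u ->
  exchange u i x = exchange u j y -> (i, x) = (j, y).
Proof.
move=> xu yu e.
have exy : x = y.
  have := codom_exchange i x xu; rewrite e codom_exchange // eqxx (negbTE xu) /= orbF.
  by move/eqP.
subst y; congr pair.
have := codom_exchange i (u i) xu; rewrite e codom_exchange // eqxx andbF orbF.
rewrite codom_f /= (inj_eq (@minrep_inj u)).
case: eqP => [eui|_ /=]; first by case/negP: xu; rewrite -eui codom_f.
by move/negbFE/eqP.
Qed.

Lemma exchange_neq u i x : x \notin codom u -> exchange u i x != u.
Proof.
move=> xu; apply/eqP => e; have := codom_exchange i x xu.
by rewrite e eqxx (negbTE xu).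
Qed.

Lemma count_le_replace u i (x : 'I_n) (k : nat) :
  count_le (replace u i x) k + (u i <= k) = count_le u k + (x <= k).
Proof.
rewrite /count_le (cardsD1 i [set j | replace u i x j <= k]).
rewrite (cardsD1 i [set j | u j <= k]) !inE {1}/replace eqxx.
suff -> : [set j | replace u i x j <= k] :\ i = [set j | u j <= k] :\ i by lia.
by apply/setP => j; rewrite !inE /replace; case: eqP.
Qed.

(** The count at [w l] becomes too small only if it was exactly [l.+1], [u i] was counted and [x] is
    not. For [l < i], a counted [u i] forces a count above [i], so there is slack. *)
Lemma brle_exchange u w i x : brle u w -> x \notin codom u ->
  brle (exchange u i x) w =
  [forall l : 'I_r, (i <= l) && (count_le u (w l) == l.+1) ==> (x <= w l)].
Proof.
move=> uw xu; rewrite brle_count; apply: eq_forallb => l.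
have [s se] := exchangeP i xu.
rewrite -(count_le_perm _ s).
have -> : count_le (exchange u i x \o s) (w l) = count_le (replace u i x) (w l).
  by apply: eq_card => k; rewrite !inE se.
have := count_le_replace u i x (w l).
have: l < count_le u (w l) by move: uw; rewrite brle_count => /forallP.
rewrite -(count_le_ltE u i); case: (leqP i l) => il /=.
  by case: eqP => [->|]; lia.
case: (x <= _); lia.
Qed.

Lemma count_le_max u (k : nat) : count_le u k <= r.
Proof. by rewrite -[X in _ <= X]card_ord; apply: max_card. Qed.

Lemma card_notin_le u (k : 'I_n) :
  #|[set x : 'I_n | (x \notin codom u) && (x <= k)]| = k.+1 - count_le u k.
Proof.
rewrite -(card_ord_le k) /count_le -(card_imset _ (@minrep_inj u)).
rewrite -cardsDS; last by apply/fintype.subsetP => y /imsetP[i + ->]; rewrite !inE.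
apply: eq_card => x; rewrite !inE; case: leqP => xk; rewrite ?andbF ?andbT //.
congr negb; apply/codomP/imsetP => [[i e]|[i _ ->]]; exists i => //.
by rewrite inE -e.
Qed.

(** Call [l] tight when the count at [w l] equals [l.+1], that is, when [l] is last or w_l <
    u_(l+1). By [brle_exchange] the constraints are [x <= w l] for tight [l >= i], and the first
    one, at [K], is the strongest. Of the values up to [w K], exactly [K.+1] belong to [u]. *)
Lemma card_exchange_row u w i : brle u w -> exists K : 'I_r,
  [/\ i <= K, count_le u (w K) = K.+1,
      forall l, i <= l -> l < K -> count_le u (w l) != l.+1 &
      #|[set x : 'I_n | (x \notin codom u) && brle (exchange u i x) w]| = w K - K].
Proof.
move=> uw; have cu l : l < count_le u (w l).
  by move: uw; rewrite brle_count => /forallP.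
have [j /= jr] : {j : 'I_r | j.+1 = r}.
  by case: r i => [[]//|m] _; exists ord_max.
(* The last index is always tight, so a least tight index exists. *)
have Pj : (i <= j) && (count_le u (w j) == j.+1).
  have := cu j; have := count_le_max u (w j); have := ltn_ord i; lia.
case: (@arg_minnP _ j (fun l => (i <= l) && (count_le u (w l) == l.+1))
  (fun l : 'I_r => l : nat) Pj) => K /andP[iK /eqP cK] minK.
exists K; split => // [l il lK|].
  by apply/negP => cl; have := minK l; rewrite il cl leqNgt lK => /(_ isT).
rewrite -[RHS](_ : (w K).+1 - count_le u (w K) = _); last by rewrite cK subSS.
rewrite -card_notin_le; apply: eq_card => x; rewrite !inE.
case xu: (x \in codom u) => //=; rewrite brle_exchange ?xu //.
apply/forallP/idP => [/(_ K)|xK l]; first by rewrite iK cK eqxx.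
apply/implyP => /minK Kl; apply: leq_trans xK _; by rewrite minrep_leE.
Qed.

Definition minrep_length w := \sum_(i < r) (w i - i).

Definition exchanges u w :=
  [set p : 'I_r * 'I_n | (p.2 \notin codom u) && brle (exchange u p.1 p.2) w].

Lemma card_exchangesE u w : #|exchanges u w| =
  \sum_(i < r) #|[set x : 'I_n | (x \notin codom u) && brle (exchange u i x) w]|.
Proof.
rewrite (eq_bigr (fun i => \sum_(x in 'I_n) ((x \notin codom u) && brle (exchange u i x) w))).
  rewrite pair_big -sum1_card big_mkcond /=; apply: eq_bigr => -[i x] _.
  by rewrite inE /=; case: ifP.
by move=> i _; rewrite -sum1_card big_mkcond /=; apply: eq_bigr => x _; rewrite inE; case: ifP.
Qed.

(** No index from [i] up to [K], excluded, is tight, so there the hypothesis forces w_(l+1) = w_l +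
    1. Hence [w l - l] is constant from [i] to [K], and each row has exactly [w i - i] members. *)
Lemma card_exchanges_eq u w : brle u w ->
  (forall i j, j = i.+1 :> nat -> (w i).+1 < w j -> w i < u j) ->
  #|exchanges u w| = minrep_length w.
Proof.
move=> uw ess; rewrite card_exchangesE; apply: eq_bigr => i _.
have [K [iK _ minK ->]] := card_exchange_row i uw.
suff H d (l : 'I_r) : l = i + d :> nat -> l <= K -> w l - l = w i - i.
  by apply: (H (K - i)) => //; rewrite subnKC.
elim: d l => [|d IHd] l li lK.
  by rewrite (_ : l = i) //; apply: val_inj => /=; rewrite li addn0.
have l'r : i + d < r by have := ltn_ord K; lia.
pose l' := Ordinal l'r.
have ll' : l = l'.+1 :> nat by rewrite /=; lia.
have <- := IHd l' erefl; last by rewrite /=; lia.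
have cl' : u l <= w l'.
  rewrite -count_le_ltE ll'; have := minK l'; rewrite /=.
  have : l' < count_le u (w l') by move: uw; rewrite brle_count => /forallP.
  by move=> /=; lia.
have := ess l' l ll'; have := @minrep_lt w l' l; have := minrep_ge w l'; rewrite /= in ll' *.
lia.
Qed.

(** Since [u j <= w i], the index [i] is not tight, so its row has [K >= j] and
    [w K - K >= w j - j > w i - i] members. No other row falls short of its term in the length. *)
Lemma card_exchanges_gt u w i j : brle u w -> j = i.+1 :> nat ->
  (w i).+1 < w j -> u j <= w i -> minrep_length w < #|exchanges u w|.
Proof.
move=> uw ji wij uj; rewrite card_exchangesE /minrep_length.
rewrite (bigD1 i) //= [X in _ < X](bigD1 i) //= -addSn.
apply: leq_add; last first.
  apply: leq_sum => k _; have [K [kK _ _ ->]] := card_exchange_row k uw.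
  exact: minrep_ge_sub.
have [K [iK cK _ ->]] := card_exchange_row i uw.
have jK : j <= K.
  rewrite ji ltn_neqAle iK andbT; apply/eqP => /val_inj e; subst K.
  by move: uj; rewrite -count_le_ltE cK ji ltnn.
have := minrep_ge_sub w jK; have := minrep_ge w i; lia.
Qed.

(** The largest [i] with [u i < w i] can be raised by one: the later entries of [u] agree with those
    of [w], so the sequence stays increasing. *)
Lemma brle_step u w : brle u w -> u != w -> exists u' i,
  [/\ u i < u' i, u' =1 replace u i (u' i) & brle u' w].
Proof.
move=> /forallP uw nuw.
have [i0 i0P] : exists i, u i < w i.
  apply/existsP; apply: contraNT nuw; rewrite negb_exists => /forallP nlt.
  by apply/eqP/minrep_eq => i; apply/val_inj/eqP; rewrite eqn_leq uw leqNgt nlt.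
case: (@arg_maxnP _ i0 (fun i => u i < w i) (fun i => i : nat) i0P) => i ui imax.
have uE k : i < k -> u k = w k.
  move=> ik; apply/val_inj/eqP; rewrite eqn_leq uw leqNgt /=.
  by apply/negP => /imax; rewrite /= leqNgt ik.
pose j := Ordinal (leq_ltn_trans ui (ltn_ord (w i))).
have [u' u'E] : {u' : minrep r n | u' =1 replace u i j}.
  apply: minrep_of => a b ab; rewrite /replace.
  case: (eqVneq a i) => [ai|_]; case: (eqVneq b i) => [bi|_].
  - by rewrite ai bi ltnn in ab.
  - by rewrite ai in ab; rewrite uE // (leq_ltn_trans ui) // minrep_ltE.
  - by rewrite bi in ab; rewrite ltnS ltnW // minrep_ltE.
  - by rewrite minrep_ltE.
have u'i : u' i = j by rewrite u'E /replace eqxx.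
exists u', i; rewrite u'i; split => //; apply/forallP => k; rewrite u'E /replace.
by case: (eqVneq k i) => [->|_].
Qed.

(** The least [i] with [i < w i] can be lowered by one, since the entries before it are 0, ..., i -
    1. *)
Lemma minrep_length_step w : 0 < minrep_length w -> exists u i,
  [/\ u i < w i, w =1 replace u i (w i) & minrep_length w = (minrep_length u).+1].
Proof.
move=> wpos; have [i0 i0P] : exists i : 'I_r, i < w i.
  apply/existsP; apply: contraTT wpos; rewrite negb_exists => /forallP nlt.
  by rewrite -leqNgt leqn0; apply/eqP/big1 => i _; apply/eqP; rewrite subn_eq0 leqNgt nlt.
case: (@arg_minnP _ i0 (fun i => i < w i) (fun i => i : nat) i0P) => i wi imin.
have wE k : k < i -> w k = k :> nat.
  move=> ki; apply/eqP; rewrite eqn_leq minrep_ge andbT leqNgt.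
  by apply/negP => /imin; rewrite /= leqNgt ki.
have lt : (w i).-1 < n by rewrite (leq_ltn_trans (leq_pred _)).
pose j := Ordinal lt.
have jS : w i = j.+1 :> nat by rewrite /= prednK // (leq_ltn_trans _ wi).
have [u uE] : {u : minrep r n | u =1 replace w i j}.
  apply: minrep_of => a b ab; rewrite /replace.
  case: (eqVneq a i) => [ai|_]; case: (eqVneq b i) => [bi|_].
  - by rewrite ai bi ltnn in ab.
  - rewrite ai in ab; apply: (@ltn_trans (w i)); last by rewrite minrep_ltE.
    by rewrite jS.
  - by rewrite bi in ab; rewrite wE // (leq_trans ab) // -ltnS -jS.
  - by rewrite minrep_ltE.
have ui : u i = j by rewrite uE /replace eqxx.
exists u, i; split.
- by rewrite ui jS.
- by move=> k; rewrite /replace uE /replace; case: (eqVneq k i) => [->|].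
rewrite /minrep_length (bigD1 i) //= [X in _ = X.+1](bigD1 i) //= ui -addSn.
congr (_ + _); first by rewrite jS /= subSn // -ltnS -jS.
by apply: eq_bigr => k /negbTE ki; rewrite uE /replace ki.
Qed.

Lemma minrep_codom_eq t v : (forall i, t i \in codom v) -> t = v.
Proof.
move=> tv; pose s i := iinv (tv i).
have sE i : v (s i) = t i by apply: f_iinv.
have s_inj : injective s by move=> i j e; apply: (@minrep_inj t); rewrite -!sE e.
apply: (@rearrangement_uniq t v 1%g (perm s_inj)) => i.
by rewrite /= perm1 permE sE.
Qed.

(** If [t i1] were the only value outside [u], then [t] would be the exchange of [t i1] for the
    entry [u i0] that [t] misses. Two outside values are what makes a Plucker determinant vanish to
    second order. *)
Lemma minrep_two_outside t u : t != u ->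
  (forall i x, x \notin codom u -> t != exchange u i x) ->
  exists i1 i2, [/\ i1 != i2, t i1 \notin codom u & t i2 \notin codom u].
Proof.
move=> tu text.
have [i1 ti1] : exists i, t i \notin codom u.
  apply/existsP; apply: contraNT tu; rewrite negb_exists => /forallP h.
  by apply/eqP/minrep_codom_eq => i; have := h i; rewrite negbK.
suff [i2 /andP[i12 ti2]] : exists i2, (i1 != i2) && (t i2 \notin codom u) by exists i1, i2.
apply/existsP; rewrite -[[exists _, _]]negbK negb_exists; apply/negP => /forallP h.
have {}h i : i1 != i -> t i \in codom u.
  by move=> i1i; have := h i; rewrite i1i negbK.
have [i0 ui0] : exists i, u i \notin codom t.
  apply/existsP; rewrite -[[exists _, _]]negbK negb_exists; apply/negP => /forallP ut.
  have e : u = t by apply: minrep_codom_eq => i; have := ut i; rewrite negbK.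
  by rewrite e codom_f in ti1.
have /eqP[] := text i0 _ ti1; apply: minrep_codom_eq => i.
rewrite codom_exchange //; case: (eqVneq (t i) (t i1)) => //= titi1.
rewrite h /=; first by apply: contraNneq ui0 => <-; apply: codom_f.
by apply: contraNneq titi1 => ->.
Qed.

End Minrep.

Local Open Scope ring_scope.
Local Open Scope classical_set_scope.

(** * Polynomial functions *)

Section PolynomialFunctions.
Variables (K : numFieldType).

(** Only nonzero [t] are tested because the families used later degenerate at 0; in characteristic 0
    the integers 1, 2, 3, ... are enough roots. *)
Lemma poly_eq0_horner (p : {poly K}) : (forall t, t != 0 -> p.[t] = 0) -> p = 0.
Proof.
move=> p0; apply/eqP/negPn/negP => pn0.
have := @max_poly_roots _ p [seq i.+1%:R | i <- iota 0 (size p)] pn0.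
rewrite size_map size_iota ltnn => H; apply/notF/H.
  by apply/allP => _ /mapP[i _ ->]; rewrite rootE p0 // pnatr_eq0.
rewrite map_inj_uniq ?iota_uniq // => i j /eqP.
by rewrite eqr_nat => /eqP[].
Qed.

Variable N : nat.
Implicit Types (f g : {mpoly K[N]}) (x y : 'rV[K]_N).

Lemma mpoly_closed_ind (P : {mpoly K[N]} -> Prop) :
  (forall c, P c%:MP) -> (forall i, P 'X_i) ->
  (forall f g, P f -> P g -> P (f + g)) -> (forall f g, P f -> P g -> P (f * g)) ->
  forall f, P f.
Proof.
move=> PC PX PD PM f; rewrite (mpolyE f).
apply: big_ind => [||m _]; [by rewrite -mpolyC0|by []|].
rewrite -mul_mpolyC mpolyXE_id; apply: (PM) => //.
apply: big_ind => [||i _]; [by rewrite -mpolyC1|by []|].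
elim: (m i) => [|k IHk]; first by rewrite expr0 -mpolyC1.
by rewrite exprS; apply: PM.
Qed.

Lemma horner_mmap (c : 'I_N -> {poly K}) f t :
  (mmap (@polyC K) c f).[t] = f.@[fun i => (c i).[t]].
Proof.
elim/mpoly_closed_ind: f => [a|i|f g IHf IHg|f g IHf IHg].
- by rewrite mmapC mevalC hornerC.
- by rewrite mmapX mmap1U mevalXU.
- by rewrite mmapD mevalD hornerD IHf IHg.
- by rewrite rmorphM mevalM hornerM IHf IHg.
Qed.

Definition dirder f x y := \sum_(i < N) (mderiv i f).@[x 0] * y 0 i.

(** Allows the tangent equations to be computed from any convenient [p] with the values of [f] along
    the line: over an infinite field the values determine [p]. *)
Lemma dirder_horner f x y (p : {poly K}) :
  (forall t, p.[t] = f.@[(x + t *: y) 0]) -> dirder f x y = p^`().[0].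
Proof.
pose c i := (x 0 i)%:P + (y 0 i) *: 'X.
move=> pE.
have {pE} -> : p = mmap (@polyC K) c f.
  apply/eqP; rewrite -subr_eq0; apply/eqP/poly_eq0_horner => t _.
  rewrite hornerD hornerN horner_mmap pE; apply/eqP; rewrite subr_eq0; apply/eqP.
  by apply: meval_eq => i; rewrite !mxE /c !hornerE mulrC.
have c0 h : (mmap (@polyC K) c h).[0] = h.@[x 0].
  by rewrite horner_mmap; apply: meval_eq => i; rewrite /c !hornerE.
rewrite /dirder; elim/mpoly_closed_ind: f => [a|i|f g IHf IHg|f g IHf IHg].
- by rewrite mmapC derivC horner0 big1 // => i _; rewrite mderivC meval0 mul0r.
- rewrite mmapX mmap1U /c derivD derivC derivZ derivX add0r !hornerE.
  rewrite (bigD1 i) //= big1 => [|j /negbTE ji]; rewrite mderivX mnm1E.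
    rewrite addr0 eqxx scale1r (_ : (U_(i) - U_(i))%MM = 0%MM) ?mpolyX0 ?meval1 ?mul1r //.
    by apply/mnmP => j; rewrite mnmBE subnn mnm0E.
  by rewrite eq_sym ji scale0r meval0 mul0r.
- rewrite mmapD derivD hornerD -IHf -IHg -big_split; apply: eq_bigr => i _ /=.
  by rewrite mderivD mevalD mulrDl.
- rewrite rmorphM derivM hornerD !hornerM -IHf -IHg !c0 mulr_suml mulr_sumr -big_split.
  apply: eq_bigr => i _ /=; rewrite mderivM mevalD !mevalM mulrDl mulrA.
  by rewrite mulrAC.
Qed.

Lemma dhomog_meval d f x (a : K) : f \is d.-homog ->
  f.@[(a *: x) 0] = a ^+ d * f.@[x 0].
Proof.
move=> /dhomogP fd; rewrite !mevalE mulr_sumr big_seq [RHS]big_seq.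
apply: eq_bigr => m /fd /= <-; rewrite mulrCA; congr *%R.
rewrite mdegE -prodrXr -big_split; apply: eq_bigr => i _ /=.
by rewrite mxE exprMn.
Qed.

Lemma dhomog_bigprod (I : Type) (s : seq I) (P : pred I) M (F : I -> {mpoly K[M]}) (e : I -> nat) :
  (forall i, P i -> F i \is (e i).-homog) ->
  \prod_(i <- s | P i) F i \is (\sum_(i <- s | P i) e i)%N.-homog.
Proof.
move=> Fe; elim: s => [|i s IHs]; first by rewrite !big_nil dhomog1.
by rewrite !big_cons; case: ifP => // Pi; rewrite dhomogM ?Fe.
Qed.

Lemma dhomog_X i : ('X_i : {mpoly K[N]}) \is 1.-homog.
Proof. by rewrite dhomogX; apply/eqP; apply: mdeg1. Qed.

Lemma meval_comp_mktuple M (F : 'I_N -> {mpoly K[M]}) f (t : 'I_M -> K) :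
  (f \mPo [tuple F i | i < N]).@[t] = f.@[fun i => (F i).@[t]].
Proof. by rewrite comp_mpoly_meval; apply: meval_eq => i; rewrite tnth_mktuple. Qed.

Lemma dhomog_comp M (F : 'I_N -> {mpoly K[M]}) d f :
  (forall i, F i \is 1.-homog) -> f \is d.-homog ->
  f \mPo [tuple F i | i < N] \is d.-homog.
Proof.
move=> F1 /dhomogP fd; rewrite comp_mpolyE big_seq; apply: rpred_sum => m /fd /= <-.
apply: rpredZ; rewrite mdegE; apply: dhomog_bigprod => i _.
by rewrite tnth_mktuple -[X in X.-homog]mul1n; apply: dhomogMn.
Qed.

(** For a nonzero polynomial [msize] is the degree plus one, so a bound [a.+1] means degree at most
    [a]. *)
Lemma msizeM_bound M (p q : {mpoly K[M]}) a b :
  (msize p <= a.+1)%N -> (msize q <= b.+1)%N -> (msize (p * q) <= (a + b).+1)%N.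
Proof.
have [->|p0] := eqVneq p 0; first by rewrite mul0r msize0.
have [->|q0] := eqVneq q 0; first by rewrite mulr0 msize0.
rewrite msizeM // => pa qb.
by rewrite -subn1 leq_subLR add1n -addSn -addnS leq_add.
Qed.

Lemma msize_prod_bound M (I : Type) (s : seq I) (F : I -> {mpoly K[M]}) (e : I -> nat) :
  (forall i, (msize (F i) <= (e i).+1)%N) ->
  (msize (\prod_(i <- s) F i) <= (\sum_(i <- s) e i).+1)%N.
Proof.
move=> Fe; elim: s => [|i s IHs]; first by rewrite !big_nil msize1.
by rewrite !big_cons; apply: msizeM_bound.
Qed.

Lemma msize_comp M (F : 'I_N -> {mpoly K[M]}) d e f :
  (forall i, (msize (F i) <= e.+1)%N) -> f \is d.-homog ->
  (msize (f \mPo [tuple F i | i < N]) <= (d * e).+1)%N.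
Proof.
move=> Fe /dhomogP fd; rewrite comp_mpolyE big_seq.
apply: (big_ind (fun p : {mpoly K[M]} => (msize p <= (d * e).+1)%N)).
- by rewrite msize0.
- by move=> p q pd qd; apply: leq_trans (mmeasureD_le _ _ _) _; rewrite geq_max pd.
move=> m /fd /= <-; apply: leq_trans (msizeZ_le _ _) _.
rewrite mdegE big_distrl /=; apply: msize_prod_bound => i; rewrite tnth_mktuple.
elim: (m i) => [|k IHk]; first by rewrite expr0 msize1.
by rewrite exprS mulSn; apply: msizeM_bound.
Qed.

End PolynomialFunctions.

(** * Projective sets and their dimension *)

Section Projective.
Variables (K : numFieldType) (N : nat).
Implicit Types (X Y Z : set 'rV[K]_N) (x y : 'rV[K]_N) (f g : {mpoly K[N]}).

Lemma vanishes_on_closure X d f : f \is d.-homog ->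
  vanishes_on X f -> vanishes_on (zariski_closure X) f.
Proof. by move=> fd fX x [_ Xx]; apply: (Xx d). Qed.

Lemma sub_zariski_closure X : ~ X 0 -> X `<=` zariski_closure X.
Proof.
move=> X0 x Xx; split; first by apply/eqP => x0; apply: X0; rewrite -x0.
by move=> d f _; apply.
Qed.

Lemma zariski_closure_closed X : zariski_closed (zariski_closure X).
Proof.
rewrite /zariski_closed; apply/seteqP; split => x [x0 Xx]; split => // d f fd fX.
  by apply: (Xx d) => //; apply: (vanishes_on_closure fd).
by apply: fX; split.
Qed.

Lemma zariski_closure_min X Z : zariski_closed Z -> X `<=` Z -> zariski_closure X `<=` Z.
Proof.
move=> Zc XZ x [x0 Xx]; rewrite -Zc; split => // d f fd fZ.
by apply: (Xx d) => // y /XZ; apply: fZ.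
Qed.

Lemma zariski_closed_neq0 Z x : zariski_closed Z -> Z x -> x != 0.
Proof. by move=> <- -[]. Qed.

Lemma zariski_closed_scale Z (a : K) x : zariski_closed Z -> a != 0 -> Z x -> Z (a *: x).
Proof.
move=> Zc a0 Zx; rewrite -Zc; split.
  by rewrite scaler_eq0 negb_or a0; apply: zariski_closed_neq0 Zx.
by move=> d f fd fZ; rewrite (dhomog_meval _ _ fd) fZ ?mulr0.
Qed.

Lemma zariski_closed_hypersurface d f : f \is d.-homog ->
  zariski_closed [set x : 'rV[K]_N | x != 0 /\ f.@[x 0] = 0].
Proof.
move=> fd; apply/seteqP; split => x /= [x0 fx]; split => //.
  by apply: (fx d) => // y [].
by move=> e g _; apply.
Qed.

Lemma irreducible_mul Z d e f g : irreducible_closed Z ->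
  f \is d.-homog -> g \is e.-homog -> vanishes_on Z (f * g) ->
  vanishes_on Z f \/ vanishes_on Z g.
Proof.
move=> [Zc _ Zirr] fd ge fg.
have Zfg : Z `<=` [set x : 'rV[K]_N | x != 0 /\ f.@[x 0] = 0] `|`
    [set x : 'rV[K]_N | x != 0 /\ g.@[x 0] = 0].
  move=> x Zx; have x0 := zariski_closed_neq0 Zc Zx.
  have /eqP := fg x Zx; rewrite mevalM mulf_eq0 => /orP[]/eqP; by [left|right].
by have [H|H] := Zirr _ _ (zariski_closed_hypersurface fd)
  (zariski_closed_hypersurface ge) Zfg; [left|right] => x /H [].
Qed.

Lemma irreducible_exp Z d f k : irreducible_closed Z -> f \is d.-homog ->
  vanishes_on Z (f ^+ k) -> vanishes_on Z f.
Proof.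
move=> Zirr fd; elim: k => [|k IHk].
  case: (Zirr) => _ [x Zx] _ /(_ x Zx) /eqP.
  by rewrite expr0 meval1 oner_eq0.
by rewrite exprS => /(irreducible_mul Zirr fd (dhomogMn k fd))[].
Qed.

Lemma irreducible_prod (I : finType) (e : I -> nat) (F : I -> {mpoly K[N]}) Z :
  irreducible_closed Z -> (forall i, F i \is (e i).-homog) ->
  vanishes_on Z (\prod_i F i) -> exists i, vanishes_on Z (F i).
Proof.
move=> Zirr Fe; suff H (s : seq I) : vanishes_on Z (\prod_(i <- s) F i) ->
  exists i, vanishes_on Z (F i) by apply: H.
elim: s => [|i s IHs].
  case: (Zirr) => _ [x Zx] _ /(_ x Zx) /eqP.
  by rewrite big_nil meval1 oner_eq0.
rewrite big_cons.
have Fs := dhomog_bigprod s (P := predT) (fun i _ => Fe i).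
by case/(irreducible_mul Zirr (Fe i) Fs) => [Fi|/IHs //]; exists i.
Qed.

(** * Growth of spaces of forms as a bound on Krull dimension *)

Definition independent_on Z (T : finType) (G : T -> {mpoly K[N]}) : Prop :=
  forall a : T -> K, vanishes_on Z (\sum_t a t *: G t) -> forall t, a t = 0.

(** Stands in for a Hilbert polynomial of degree at least [d]. The constant [D] is fixed before [m],
    so the degrees of the forms grow only linearly in [m]. *)
Definition has_independent_forms Z (d : nat) : Prop :=
  exists D : nat, forall m : nat, exists (T : finType) (G : T -> {mpoly K[N]}),
    [/\ #|T| = (m ^ d)%N, forall t, G t \is (D * m).-homog & independent_on Z G].

Lemma exists_coord Z : zariski_closed Z -> Z !=set0 ->
  exists i : 'I_N, ~ vanishes_on Z ('X_i).
Proof.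
move=> Zc [x Zx]; have := zariski_closed_neq0 Zc Zx.
move=> /rV0Pn[i xi]; exists i => /(_ x Zx) /eqP.
by rewrite mevalXU (negbTE xi).
Qed.

Lemma independent_forms0 Z : irreducible_closed Z -> has_independent_forms Z 0.
Proof.
move=> Zirr; case: (Zirr) => Zc Z0 _.
have [i Xi] := exists_coord Zc Z0.
exists 1%N => m; exists unit, (fun=> 'X_i ^+ m); split; first by rewrite card_unit expn0.
- by move=> _; apply: dhomogMn; apply: dhomog_X.
move=> a; rewrite (bigD1 tt) //= big1 ?addr0 => [aX []|[]//].
apply/eqP/negPn/negP => a0; apply: Xi.
apply: (irreducible_exp (k := m) Zirr (dhomog_X _ i)) => x Zx.
by have /eqP := aX x Zx; rewrite mevalZ mulf_eq0 (negbTE a0) => /eqP.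
Qed.

(** Let [f] vanish on [Y] but not on [Z], and let [h], of the same degree, not vanish on [Y]. If the
    [G t] are independent on [Y], then so are the [G t * f ^ k * h ^ (m - k)], [k < m], on [Z]: in a
    relation the lowest power of [f] cancels by irreducibility of [Z], restriction to [Y] kills the
    higher powers, and [h] cancels on [Y]. *)
Lemma independent_formsS Y Z d : irreducible_closed Y -> irreducible_closed Z ->
  Y `<` Z -> has_independent_forms Y d -> has_independent_forms Z d.+1.
Proof.
move=> Yirr Zirr [YZ nZY] [D indY].
have [Yc Y0 _] := Yirr; have [Zc _ _] := Zirr.
have [e [f [fe fY fZ]]] : exists e f, [/\ f \is e.-homog, vanishes_on Y f & ~ vanishes_on Z f].
  apply: contra_notP nZY => nf z Zz; rewrite -Yc; split.
    exact: zariski_closed_neq0 Zz.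
  move=> e f fe fY; apply: contrapT => fz; apply: nf.
  by exists e, f; split => // /(_ z Zz).
have [i Xi] := exists_coord Yc Y0.
pose h : {mpoly K[N]} := 'X_i ^+ e.
have he : h \is e.-homog by rewrite -[e]mul1n; apply: dhomogMn; apply: dhomog_X.
have hY : ~ vanishes_on Y h by move=> /(irreducible_exp Yirr (dhomog_X _ i)).
exists (D + e)%N => m; have [T [G [cT GD Gind]]] := indY m.
pose F (p : T * 'I_m) := G p.1 * f ^+ p.2 * h ^+ (m - p.2).
exists (T * 'I_m)%type, F; split.
- by rewrite card_prod cT card_ord expnSr.
- move=> [t k]; rewrite /F /=.
  rewrite (_ : ((D + e) * m = D * m + e * k + e * (m - k))%N); last first.
    by rewrite mulnDl -addnA -mulnDr subnKC // ltnW.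
  by rewrite !dhomogM ?dhomogMn ?GD.
move=> a aF; suff H (k : 'I_m) t : a (t, k) = 0 by case.
(* Strong induction on the exponent of [f]: the coefficients at smaller exponents are already
   zero. *)
elim/ltn_ind: {k}(k : nat) {-2}k (erefl (k : nat)) t => q IHq k kq.
subst q.
pose rest := \sum_(p : T * 'I_m | (k < p.2)%N) a p *: (G p.1 * f ^+ (p.2 - k.+1) * h ^+ (m - p.2)).
pose low := (\sum_t a (t, k) *: G t).
have lowD : low \is (D * m).-homog by apply: rpred_sum => t _; apply: rpredZ.
have lowhD : low * h ^+ (m - k) \is (D * m + e * (m - k)).-homog.
  by rewrite dhomogM ?dhomogMn.
have restD : f * rest \is (D * m + e * (m - k)).-homog.
  rewrite mulr_sumr; apply: rpred_sum => -[t l] /= kl; rewrite -scalerAr.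
  apply: rpredZ; rewrite mulrCA -!mulrA.
  rewrite (_ : (D * m + e * (m - k) = D * m + (e * (l - k.+1) + (e + e * (m - l))))%N); last first.
    by have := ltn_ord l; nia.
  by apply: dhomogM (GD t) _; rewrite dhomogM ?dhomogMn // dhomogM ?dhomogMn.
have E : \sum_p a p *: F p = f ^+ k * (low * h ^+ (m - k) + f * rest).
  rewrite (bigID (fun p : T * 'I_m => (k < p.2)%N)) /= addrC mulrDr; congr (_ + _).
    rewrite (bigID (fun p : T * 'I_m => p.2 == k)) /= [X in _ + X]big1 ?addr0; last first.
      move=> [t l] /= /andP[kl lk]; rewrite (IHq l) ?scale0r //.
      by move: kl lk; rewrite -leqNgt -val_eqE /= => ? ?; rewrite ltn_neqAle; apply/andP.
    rewrite mulrA [f ^+ k * low]mulr_sumr mulr_suml.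
    transitivity (\sum_t \sum_(l | l == k) a (t, l) *: F (t, l)).
      rewrite pair_big /=; apply: eq_big => [[t l]|[t l] _] //=.
      by case: eqP => [->|]; rewrite ?ltnn ?andbF.
    apply: eq_bigr => t _; rewrite big_pred1_eq /F /= -!scalerAr -scalerAl.
    by rewrite [_ * G t]mulrC.
  rewrite mulrA -exprSr mulr_sumr; apply: eq_bigr => -[t l] /= kl.
  rewrite -scalerAr /F /= !mulrA [f ^+ k.+1 * G t]mulrC -[_ * f ^+ k.+1 * _]mulrA -exprD.
  by rewrite subnKC.
rewrite E in aF.
case: (irreducible_mul Zirr (dhomogMn k fe) (rpredD lowhD restD) aF).
  by move=> /(irreducible_exp Zirr fe).
move=> lowrest; apply: Gind => y Yy.
have : vanishes_on Y (low * h ^+ (m - k)).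
  move=> z Yz; have := lowrest z (YZ z Yz).
  by rewrite mevalD [X in _ + X]mevalM (fY z Yz) mul0r addr0.
case/(irreducible_mul Yirr lowD (dhomogMn _ he)); first by apply.
by move=> /(irreducible_exp Yirr he).
Qed.

Lemma chain_independent_forms (Z : nat -> set 'rV[K]_N) d :
  (forall i, (i <= d)%N -> irreducible_closed (Z i)) ->
  (forall i, (i < d)%N -> Z i `<` Z i.+1) -> has_independent_forms (Z d) d.
Proof.
elim: d => [|d IHd] Zirr Zlt; first exact/independent_forms0/Zirr.
apply: (@independent_formsS (Z d)); [exact: Zirr|exact: Zirr|exact: Zlt|].
by apply: IHd => i id; [apply: Zirr|apply: Zlt]; rewrite ltnW.
Qed.

Lemma card_bmultinom l k : (#|{: 'X_{1..l < k}}| <= k ^ l)%N.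
Proof.
rewrite -[k in (k ^ _)%N]card_ord -[l in (_ ^ l)%N]card_ord -card_ffun.
have lt (m : 'X_{1..l < k}) i : (m i < k)%N.
  apply: leq_ltn_trans (bmdeg m); rewrite mdegE (bigD1 i) //=; exact: leq_addr.
apply: (@leq_card _ _ (fun m : 'X_{1..l < k} => [ffun i => Ordinal (lt m i)])).
move=> m m' /ffunP e; apply/val_inj/mnmP => i; have /(congr1 val) := e i.
by rewrite !ffunE.
Qed.

Lemma row_kernel m n (A : 'M[K]_(m, n)) : (n < m)%N ->
  exists2 a : 'rV[K]_m, a != 0 & a *m A = 0.
Proof.
move=> nm; have : kermx A != 0.
  by rewrite -mxrank_eq0 mxrank_ker subn_eq0 -ltnNge; apply: leq_ltn_trans (rank_leq_col A) nm.
by case/rowV0Pn => a; rewrite sub_kermx => /eqP; exists a.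
Qed.

(* Counting: [m ^ d] independent forms of degree [O(m)] would be sent to the
   [O(m ^ l)]-dimensional space of polynomials of degree [O(m)] in [l] variables. *)
Lemma dim_le_parameters X l (F : 'I_N -> {mpoly K[l]}) e :
  (forall d f, f \is d.-homog ->
     (forall t, f.@[fun i => (F i).@[t]] = 0) -> vanishes_on X f) ->
  irreducible_chain X e -> (e <= l)%N.
Proof.
move=> XF [Z [Zirr Zlt]].
have [D indZ] := chain_independent_forms (fun i ie => (Zirr i ie).1) Zlt.
pose E := \max_i msize (F i).
have FE i : (msize (F i) <= E.+1)%N by apply: leqW; apply: leq_bigmax.
(* Pullbacks have degree at most [D * m * E], so at most [(D * m * E).+1 ^ l] monomials occur; for
   [m > 0] the factor [C] absorbs the successor. *)
pose C := (D * E).+1.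
have bound m : (0 < m)%N -> (m ^ e <= (C * m) ^ l)%N.
  move=> m0; have [T [G [<- GD Gind]]] := indZ m.
  rewrite leqNgt; apply/negP => lt.
  pose k := (D * m * E).+1.
  have kC : (k <= C * m)%N by rewrite /k /C; nia.
  pose B := 'X_{1..l < k}.
  pose P t := G t \mPo [tuple F i | i < N].
  have Pk t : (msize (P t) <= k)%N by apply: msize_comp.
  pose A := \matrix_(i < #|T|, j < #|{: B}|) (P (enum_val i))@_(enum_val j).
  (* With more forms than monomials, a kernel vector is a linear relation among the pullbacks, hence
     among the forms on [X], against independence. *)
  have [|a a0 aA] := @row_kernel _ _ A.
    apply: leq_ltn_trans lt; apply: leq_trans (card_bmultinom _ _) _.
    by case: (posnP l) => [->//|l0]; rewrite leq_exp2r.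
  case/rV0Pn: a0 => i /eqP; apply.
  pose b t : K := a 0 (enum_rank t).
  suff: b (enum_val i) = 0 by rewrite /b enum_valK.
  apply: (Gind b) => x Zx; apply: (XF (D * m)%N _ _ _ x); last exact: (Zirr e (leqnn e)).2.
    by apply: rpred_sum => t _; apply: rpredZ; apply: GD.
  move=> t; rewrite -meval_comp_mktuple.
  rewrite (_ : _ \mPo _ = 0) ?meval0 // raddf_sum /=.
  apply/mpolyP => mo; rewrite mcoeff0 raddf_sum /=.
  case: (ltnP (mdeg mo) k) => [mok|kmo]; last first.
    apply: big1 => s _; rewrite comp_mpolyZ mcoeffZ.
    rewrite (memN_msupp_eq0 (msize_mdeg_ge (leq_trans (Pk s) kmo))) mulr0 //.
  have /rowP/(_ (enum_rank (BMultinom mok))) := aA.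
  rewrite !mxE (reindex (@enum_rank T)) /=; last by apply: onW_bij; apply: enum_rank_bij.
  move=> H; rewrite -[RHS]H; apply: eq_bigr => s _.
  by rewrite comp_mpolyZ mcoeffZ !mxE !enum_rankK.
rewrite leqNgt; apply/negP => le.
(* For m = C^l + 1 and e > l, the bound fails: C^l m^l < m^(l+1) <= m^e. *)
have := bound (C ^ l).+1 isT; rewrite expnMn leqNgt => /negP; apply.
apply: (@leq_trans ((C ^ l).+1 ^ l.+1)); last by rewrite leq_exp2l // ltnS expn_gt0.
by rewrite expnS ltn_pmul2r // expn_gt0.
Qed.

End Projective.

(** * Plucker coordinates *)

Section CauchyBinet.
Variables (R : comNzRingType) (r n : nat).

Lemma det_rowsub_perm (f : 'I_r -> 'I_n) (s : 'S_r) (B : 'M[R]_(n, r)) :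
  \det (rowsub (f \o s) B) = (-1) ^+ s * \det (rowsub f B).
Proof.
rewrite -det_perm -det_mulmx -row_permE; congr (\det _).
by apply/matrixP => i j; rewrite !mxE.
Qed.

Lemma det_rowsub_noninj (f : 'I_r -> 'I_n) (B : 'M[R]_(n, r)) :
  ~ injective f -> \det (rowsub f B) = 0.
Proof.
move=> /injectiveP /injectivePn[i [j ij fij]].
by apply: (determinant_alternate ij) => k; rewrite !mxE fij.
Qed.

(** An injective sequence is, in a unique way, an increasing one composed with a permutation. *)
Lemma big_injective (F : {ffun 'I_r -> 'I_n} -> R) :
  (forall f : {ffun 'I_r -> 'I_n}, ~ injective f -> F f = 0) ->
  \sum_f F f = \sum_(t : minrep r n) \sum_(s : 'S_r) F [ffun i => t (s i)].
Proof.
move=> F0; rewrite pair_big /=.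
pose h (p : minrep r n * 'S_r) := [ffun i => p.1 (p.2 i)].
have h_inj : injective h.
  move=> [t s] [t' s'] /ffunP e.
  have e' : t \o s =1 t' \o s' by move=> i; have := e i; rewrite !ffunE.
  have tt' := rearrangement_uniq e'; subst t'; congr pair.
  by apply/permP => i; apply: (@minrep_inj _ _ t); apply: e'.
rewrite -(big_imset F (in2W h_inj)) /= [RHS]big_mkcond /=; apply: eq_bigr => f _.
case: imsetP => // hf; apply: F0 => f_inj; apply: hf.
have [t [s ts]] := sorted_rearrangement f_inj.
by exists (t, s) => //; apply/ffunP => i; rewrite ffunE ts.
Qed.

Lemma cauchy_binet (A : 'M[R]_(r, n)) (B : 'M[R]_(n, r)) :
  \det (A *m B) = \sum_(t : minrep r n) \det (colsub t A) * \det (rowsub t B).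
Proof.
transitivity (\sum_(f : {ffun 'I_r -> 'I_n}) (\prod_i A i (f i)) * \det (rowsub f B)).
  rewrite /determinant.
  transitivity (\sum_(s : 'S_r) \sum_(f : {ffun 'I_r -> 'I_n})
     (-1) ^+ s * \prod_i (A i (f i) * B (f i) (s i))).
    apply: eq_bigr => s _; rewrite -mulr_sumr; congr *%R.
    rewrite -(bigA_distr_bigA (fun i k => A i k * B k (s i))) /=.
    by apply: eq_bigr => i _; rewrite mxE.
  rewrite exchange_big /=; apply: eq_bigr => f _; rewrite mulr_sumr.
  apply: eq_bigr => s _; rewrite big_split mulrCA; congr (_ * (_ * _)).
  by apply: eq_bigr => i _; rewrite mxE.
rewrite big_injective => [|f /det_rowsub_noninj ->]; last by rewrite mulr0.
apply: eq_bigr => t _; rewrite mulr_suml; apply: eq_bigr => s _.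
rewrite [X in _ * X](_ : _ = (-1) ^+ s * \det (rowsub (t : minrep r n) B)); last first.
  rewrite -det_rowsub_perm; congr (\det _).
  by apply/matrixP => i j; rewrite !mxE ffunE.
rewrite mulrA [_ * (-1) ^+ s]mulrC; congr (_ * _ * _).
by apply: eq_bigr => i _; rewrite mxE ffunE.
Qed.

End CauchyBinet.

Section Plucker.
Variables (K : numFieldType) (r n : nat).
Implicit Types (u v w t : minrep r n) (f : 'I_r -> 'I_n).
Local Notation N := #|{: minrep r n}|.
Local Notation pt := 'rV[K]_N.
Implicit Types (x y : pt) (A : 'M[K]_(n, r)) (b g : 'M[K]_n).

(** Some term of the Leibniz expansion is nonzero, so all its factors lie on or above the diagonal;
    its permutation is [s]. *)
Lemma upper_minor_neq0 b f u : is_trig_mx b^T -> \det (mxsub f u b) != 0 ->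
  exists s : 'S_r, forall i, (f i <= u (s i))%N.
Proof.
move=> /is_trig_mxP btrig d0; apply: contrapT => ns; case/eqP: d0.
rewrite /determinant big1 // => s _.
have [i /negP] : exists i, ~ (f i <= u (s i))%N.
  by apply: contra_notP ns => H; exists s => i; apply: contrapT => fi; apply: H; exists i.
rewrite -ltnNge => ui; rewrite (bigD1 i) //= mxE.
by have := btrig _ _ ui; rewrite mxE => ->; rewrite mul0r mulr0.
Qed.

Lemma upper_minor_brle b t u : is_trig_mx b^T -> \det (mxsub t u b) != 0 -> brle t u.
Proof. by move=> bt /(upper_minor_neq0 bt)[s]; apply: brle_perm. Qed.

Lemma trig1 m : is_trig_mx (1%:M : 'M[K]_m)^T.
Proof. by rewrite trmx1; apply: scalar_mx_is_trig. Qed.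

Lemma det_mxsub1 t u : \det (mxsub t u (1%:M : 'M[K]_n)) = (t == u)%:R.
Proof.
have [->|tu] := eqVneq t u.
  rewrite (_ : mxsub _ _ _ = 1%:M) ?det1 //; apply/matrixP => i j.
  by rewrite !mxE (inj_eq (@minrep_inj _ _ u)).
apply/eqP/negPn/negP => d0; case/eqP: tu; apply: brle_anti.
  exact: upper_minor_brle (trig1 n) d0.
by apply: (upper_minor_brle (trig1 n)); rewrite -det_tr trmx_mxsub trmx1.
Qed.

Definition plucker A : pt := \row_i \det (rowsub (enum_val i : minrep r n) A).

(** Plucker coordinate of an unsorted sequence: the minor of the identity is the sorting sign if [f]
    rearranges [t], and 0 otherwise, in particular when [f] repeats a value. *)
Definition pcoord f x : K :=
  \sum_(t : minrep r n) \det (mxsub f t (1%:M : 'M[K]_n)) * x 0 (enum_rank t).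

Lemma pcoord_minrep t x : pcoord t x = x 0 (enum_rank t).
Proof.
rewrite /pcoord (bigD1 t) //= big1 => [|u /negbTE ut].
  by rewrite det_mxsub1 eqxx mul1r addr0.
by rewrite det_mxsub1 eq_sym ut mul0r.
Qed.

Lemma pcoord_plucker f A : pcoord f (plucker A) = \det (rowsub f A).
Proof.
have -> : rowsub f A = rowsub f 1%:M *m A by rewrite mul_rowsub_mx mul1mx.
rewrite cauchy_binet; apply: eq_bigr => t _.
by rewrite mxE enum_rankK; congr (\det _ * _); apply/matrixP => i j; rewrite !mxE.
Qed.

Lemma pcoord_perm f (s : 'S_r) x : pcoord (f \o s) x = (-1) ^+ s * pcoord f x.
Proof.
rewrite /pcoord mulr_sumr; apply: eq_bigr => t _; rewrite mulrA; congr *%R.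
have := det_rowsub_perm f s (colsub (t : minrep r n) 1%:M : 'M[K]_(n, r)).
by rewrite -!mxsub_comp.
Qed.

Lemma pcoord_noninj f x : ~ injective f -> pcoord f x = 0.
Proof.
move=> nf; rewrite /pcoord big1 // => t _.
have := det_rowsub_noninj (colsub (t : minrep r n) 1%:M : 'M[K]_(n, r)) nf.
by rewrite -mxsub_comp => ->; rewrite mul0r.
Qed.

Lemma eq_pcoord f f' x : f =1 f' -> pcoord f x = pcoord f' x.
Proof. by move=> /funext ->. Qed.

Lemma pcoordP x y : (forall t, pcoord t x = pcoord t y) -> x = y.
Proof.
move=> e; apply/rowP => i; have := e (enum_val i).
by rewrite !pcoord_minrep enum_valK.
Qed.

Lemma pcoordZ f (a : K) x : pcoord f (a *: x) = a * pcoord f x.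
Proof. by rewrite /pcoord mulr_sumr; apply: eq_bigr => t _; rewrite mxE mulrCA. Qed.

Lemma pcoordD f x y : pcoord f (x + y) = pcoord f x + pcoord f y.
Proof. by rewrite /pcoord -big_split; apply: eq_bigr => t _; rewrite mxE mulrDr. Qed.

Lemma pcoord_neq0 x : x != 0 -> exists t, pcoord t x != 0.
Proof.
move=> /rV0Pn[i xi]; exists (enum_val i).
by rewrite pcoord_minrep enum_valK.
Qed.

Definition wedge f : pt := plucker (colsub f 1%:M).

Lemma pcoord_wedge f t : pcoord t (wedge f) = \det (mxsub t f (1%:M : 'M[K]_n)).
Proof. by rewrite pcoord_plucker -mxsub_comp. Qed.

Lemma wedge_basisE u : wedge_basis K u = wedge u.
Proof.
apply: pcoordP => t; rewrite pcoord_wedge pcoord_minrep det_mxsub1 mxE.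
by rewrite (inj_eq enum_rank_inj).
Qed.

Lemma wedge_perm f (s : 'S_r) : wedge (f \o s) = (-1) ^+ s *: wedge f.
Proof.
apply: pcoordP => t; rewrite pcoordZ !pcoord_wedge.
have := det_rowsub_perm f s (colsub (t : minrep r n) 1%:M : 'M[K]_(n, r)).
rewrite -!mxsub_comp -[LHS]det_tr -[in RHS]det_tr !trmx_mxsub trmx1.
by [].
Qed.

Lemma pcoord_act f g x :
  pcoord f (wedge_act g x) = \sum_(t : minrep r n) \det (mxsub f t g) * pcoord t x.
Proof.
rewrite {1}/pcoord.
transitivity (\sum_(u : minrep r n) \sum_(t : minrep r n)
   \det (mxsub f u (1%:M : 'M[K]_n)) * \det (mxsub u t g) * x 0 (enum_rank t)).
  apply: eq_bigr => u _; rewrite mxE mulr_sumr (reindex (@enum_rank (minrep r n))) /=.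
    by apply: eq_bigr => t _; rewrite !enum_rankK mulrA.
  by apply: onW_bij; apply: enum_rank_bij.
rewrite exchange_big /=; apply: eq_bigr => t _; rewrite -mulr_suml pcoord_minrep.
congr *%R; rewrite -[g in RHS]mul1mx mxsub_mul cauchy_binet.
by apply: eq_bigr => u _; rewrite -!mxsub_comp.
Qed.

Lemma wedge_act_plucker g A : wedge_act g (plucker A) = plucker (g *m A).
Proof.
apply: pcoordP => u; rewrite pcoord_act pcoord_plucker -mul_rowsub_mx cauchy_binet.
by apply: eq_bigr => t _; rewrite pcoord_plucker -mxsub_comp.
Qed.

Lemma wedge_actM g g' x : wedge_act g (wedge_act g' x) = wedge_act (g *m g') x.
Proof.
apply: pcoordP => u; rewrite !pcoord_act.
under eq_bigr do rewrite pcoord_act mulr_sumr.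
rewrite exchange_big /=; apply: eq_bigr => t _.
rewrite mxsub_mul cauchy_binet mulr_suml; apply: eq_bigr => v _.
by rewrite -!mxsub_comp mulrA.
Qed.

Lemma wedge_act1 x : wedge_act 1%:M x = x.
Proof.
by apply: pcoordP => u; rewrite pcoord_act; apply: eq_bigr => t _; rewrite pcoord_minrep.
Qed.

Definition wedge_mx g : 'M[K]_N :=
  \matrix_(j, i) \det (mxsub (enum_val i : minrep r n) (enum_val j : minrep r n) g).

Lemma wedge_mxE g x : wedge_act g x = x *m wedge_mx g.
Proof.
by apply/rowP => i; rewrite !mxE; apply: eq_bigr => j _; rewrite !mxE mulrC.
Qed.

Lemma wedge_mxM g g' : wedge_mx g' *m wedge_mx g = wedge_mx (g *m g').
Proof.
apply/row_matrixP => i; rewrite !rowE mulmxA -!wedge_mxE.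
exact: wedge_actM.
Qed.

Lemma wedge_mx1 : wedge_mx 1%:M = 1%:M.
Proof. by apply/row_matrixP => i; rewrite !rowE mulmx1 -wedge_mxE wedge_act1. Qed.

(* Cramer's rule expresses the entries of [M_f M_u^-1], where [M_f] consists of the
   rows [f] of [M], as quotients of minors. *)
Lemma plucker_relation (R : comNzRingType) (M : 'M[R]_(n, r)) u f :
  \det (rowsub u M) ^+ r * \det (rowsub f M) = \det (rowsub u M) *
    \det (\matrix_(i, j) \det (rowsub (replace u j (f i)) M)).
Proof.
have -> : \matrix_(i, j) \det (rowsub (replace u j (f i)) M)
    = rowsub f M *m \adj (rowsub u M).
  apply/matrixP => i j; rewrite !mxE (expand_det_row _ j); apply: eq_bigr => k _.
  rewrite !mxE /replace eqxx; congr (_ * (_ * \det _)).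
  apply/matrixP => p q; by rewrite !mxE ifN // eq_sym neq_lift.
rewrite det_mulmx mulrCA -det_mulmx mul_mx_adj det_scalar mulrC //.
Qed.

(** Where [pcoord u x] is nonzero, this expresses all coordinates through those that differ from [u]
    in one entry. The factor on the right comes from [\det M * \det (\adj M) = \det M ^ r]. *)
Definition satisfies_plucker x := forall u f,
  pcoord u x ^+ r * pcoord f x =
    pcoord u x * \det (\matrix_(i, j) pcoord (replace u j (f i)) x).

Lemma plucker_satisfies A : satisfies_plucker (plucker A).
Proof.
move=> u f; rewrite !pcoord_plucker plucker_relation; congr (_ * \det _).
by apply/matrixP => i j; rewrite !mxE pcoord_plucker.
Qed.

(** Reduced column echelon form with pivot rows [u]: the normal form for a subspace in the cell of
    [u]. *)
Definition echelon u A : Prop :=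
  (forall i k, A (u i) k = (i == k)%:R) /\ (forall i (j : 'I_n), (u i < j)%N -> A j i = 0).

Lemma echelon_cell u A (c : K) : c != 0 -> echelon u A -> schubert_cell K u (c *: plucker A).
Proof.
move=> c0 [A1 A0].
(* Completion of [A] to an upper unitriangular matrix: column [u i] is column [i] of [A], the other
   columns are those of the identity. *)
pose b : 'M[K]_n := \matrix_(j, k)
  if [pick i | u i == k] is Some i then A j i else (j == k)%:R.
have bu j i : b j (u i) = A j i.
  rewrite mxE; case: pickP => [k /eqP/minrep_inj -> //|/(_ i)].
  by rewrite eqxx.
have b1 j : b j j = 1.
  rewrite mxE; case: pickP => [i /eqP <-|_]; last by rewrite eqxx.
  by rewrite A1 eqxx.
have btrig : is_trig_mx b^T.
  apply/is_trig_mxP => k j kj; rewrite !mxE; case: pickP => [i /eqP uik|_].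
    by apply: A0; rewrite uik.
  by rewrite -val_eqE gtn_eqF.
exists b, c; split => //.
  split => //; rewrite -det_tr det_trig // big1 // => i _; rewrite mxE; exact: b1.
rewrite wedge_basisE wedge_act_plucker; congr (_ *: plucker _).
by apply/matrixP => j i; rewrite mulmx_colsub mulmx1 !mxE -bu !mxE.
Qed.

Lemma pcoord_cell_brle u x t : schubert_cell K u x -> pcoord t x != 0 -> brle t u.
Proof.
move=> [b [c [[bt _] c0 ->]]]; rewrite pcoordZ mulf_eq0 negb_or => /andP[_].
rewrite wedge_basisE wedge_act_plucker pcoord_plucker.
rewrite mulmx_colsub mulmx1 -mxsub_comp; exact: upper_minor_brle.
Qed.

Lemma borel_diag_neq0 b i : borel b -> b i i != 0.
Proof.
move=> [bt]; rewrite -det_tr det_trig // => d1.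
have : \prod_j b^T j j != 0 by rewrite d1 oner_eq0.
by move/prodf_neq0/(_ i isT); rewrite mxE.
Qed.

Lemma pcoord_cell_neq0 u x : schubert_cell K u x -> pcoord u x != 0.
Proof.
move=> [b [c [bB c0 ->]]]; rewrite pcoordZ mulf_neq0 //.
rewrite wedge_basisE wedge_act_plucker pcoord_plucker.
rewrite mulmx_colsub mulmx1 -mxsub_comp -det_tr det_trig.
  by apply/prodf_neq0 => i _; rewrite !mxE; apply: borel_diag_neq0.
case: bB => /is_trig_mxP bt _; apply/is_trig_mxP => i j ij.
by have := bt (u i) (u j); rewrite !mxE minrep_ltE; apply.
Qed.

Lemma cell_satisfies u x : schubert_cell K u x -> satisfies_plucker x.
Proof.
move=> [b [c [bB c0 ->]]] t f; rewrite wedge_basisE wedge_act_plucker.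
set A := _ *m _; have := plucker_satisfies A t f; rewrite !pcoordZ => e.
rewrite exprMn mulrACA e.
have -> : \matrix_(i, j) pcoord (replace t j (f i)) (c *: plucker A)
   = c *: \matrix_(i, j) pcoord (replace t j (f i)) (plucker A).
  by apply/matrixP => i j; rewrite !mxE pcoordZ.
by rewrite detZ [c ^+ r * c]mulrC mulrACA.
Qed.

(* [u] is the largest index of a nonzero coordinate, so the matrix of
   [plucker_relation] normalised at [u] is in echelon form. *)
Lemma plucker_echelon x : x != 0 -> satisfies_plucker x ->
  exists u A (c : K), [/\ c != 0, echelon u A, pcoord u x != 0 & x = c *: plucker A].
Proof.
move=> /pcoord_neq0[t0 t00] xP.
have [u xu umax] : exists2 u : minrep r n, pcoord u x != 0 &
    forall t : minrep r n, pcoord t x != 0 -> (\sum_i t i <= \sum_i u i)%N.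
  by case: (@arg_maxnP _ t0 (fun t => pcoord t x != 0) (fun t => \sum_i t i)%N t00) => u; exists u.
pose A : 'M[K]_(n, r) := \matrix_(j, i) (pcoord (replace u i j) x / pcoord u x).
exists u, A, (pcoord u x); split => //.
  split=> [k i|i j uij]; rewrite mxE.
    case: (eqVneq k i) => [->|ki].
      by rewrite (eq_pcoord _ (replace_id _ _)) divff.
    rewrite pcoord_noninj ?mul0r // => /(_ i k); rewrite /replace eqxx (negbTE ki).
    by move=> /(_ erefl) ik; rewrite ik eqxx in ki.
  have [/codomP[k jk]|ju] := boolP (j \in codom u).
    rewrite pcoord_noninj ?mul0r // => /(_ i k); rewrite /replace eqxx jk; case: eqP.
      by move=> ki; rewrite jk ki ltnn in uij.
    by move=> ki /(_ erefl) ik; apply: ki.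
  (* Replacing [u i] by the larger [j] raises the sum of the entries, so the maximality of [u] makes
     this coordinate vanish. *)
  have [s es] := exchangeP i ju.
  rewrite (eq_pcoord _ es) pcoord_perm [pcoord (exchange _ _ _) _](_ : _ = 0) ?mulr0 ?mul0r //.
  apply/eqP/negPn/negP => /umax; apply/negP; rewrite -ltnNge.
  rewrite [X in (_ < X)%N](reindex_inj (@perm_inj _ s)) /=.
  rewrite (bigD1 i) //= [X in (_ < X)%N](bigD1 i) //= -addSn leq_add //.
    by have := es i; rewrite /replace eqxx /= => <-.
  apply: leq_sum => k /negbTE ki; have := es k; rewrite /replace ki /= => <-.
  by [].
apply: pcoordP => t; rewrite pcoordZ pcoord_plucker.
have /eqP := xP u t.
have -> : \matrix_(i, j) pcoord (replace u j (t i)) x = pcoord u x *: rowsub t A.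
  by apply/matrixP => i j; rewrite !mxE mulrC divfK.
rewrite detZ mulrCA (inj_eq (mulfI _)) ?expf_neq0 // => /eqP ->.
by [].
Qed.

Lemma satisfies_cell x : x != 0 -> satisfies_plucker x ->
  exists2 u : minrep r n, pcoord u x != 0 & schubert_cell K u x.
Proof.
move=> x0 /(plucker_echelon x0)[u [A [c [c0 uA xu xE]]]].
by exists u => //; rewrite xE; apply: echelon_cell.
Qed.

(** The echelon form provided by the Plucker relations has its own pivots [u']. Both [u] and [u']
    index nonzero coordinates and bound all such indices, so they agree. *)
Lemma cell_echelon u x : schubert_cell K u x ->
  exists A (c : K), [/\ c != 0, echelon u A & x = c *: plucker A].
Proof.
move=> xu; have xu0 := pcoord_cell_neq0 xu.
have x0 : x != 0.
  by apply/eqP => x0; move: xu0; rewrite x0 -(scale0r 0) pcoordZ mul0r eqxx.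
have [u' [A [c [c0 uA xu' xE]]]] := plucker_echelon x0 (cell_satisfies xu).
have xu'c := echelon_cell c0 uA; rewrite -xE in xu'c.
have <- : u' = u.
  by apply: brle_anti; [apply: pcoord_cell_brle xu xu'|apply: pcoord_cell_brle xu'c xu0].
by exists A, c.
Qed.

End Plucker.

(** * Linear maps, tangent spaces and Schubert cells *)

Section LinearMaps.
Variables (K : numFieldType) (N : nat).
Implicit Types (X Y Z : set 'rV[K]_N) (x y : 'rV[K]_N) (f g : {mpoly K[N]}) (M : 'M[K]_N).

Definition precomp M f : {mpoly K[N]} :=
  f \mPo [tuple \sum_j M j i *: 'X_j | i < N].

Lemma meval_precomp M f x : (precomp M f).@[x 0] = f.@[(x *m M) 0].
Proof.
rewrite meval_comp_mktuple; apply: meval_eq => i.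
rewrite raddf_sum mxE; apply: eq_bigr => j _ /=.
by rewrite mevalZ mevalXU mulrC.
Qed.

Lemma dhomog_linear (I : finType) (a : I -> K) (h : I -> 'I_N) :
  (\sum_i a i *: 'X_(h i) : {mpoly K[N]}) \is 1.-homog.
Proof. by apply: rpred_sum => i _; apply: rpredZ; apply: dhomog_X. Qed.

Lemma dhomog_precomp M d f : f \is d.-homog -> precomp M f \is d.-homog.
Proof. by apply: dhomog_comp => i; apply: (dhomog_linear _ id). Qed.

Lemma zariski_closure_mulmx X M M' x : M *m M' = 1%:M ->
  (forall z, X z -> X (z *m M)) -> zariski_closure X x -> zariski_closure X (x *m M).
Proof.
move=> MM' XM [x0 Xx]; split.
  apply: contra_neq x0 => xM; by rewrite -[x]mulmx1 -MM' mulmxA xM mul0mx.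
move=> d f fd fX; rewrite -meval_precomp.
apply: (Xx d); first exact: dhomog_precomp.
by move=> z Xz; rewrite meval_precomp; apply/fX/XM.
Qed.

Lemma dirder_precomp M f x y : dirder (precomp M f) x y = dirder f (x *m M) (y *m M).
Proof.
pose p := mmap (@polyC K) (fun i => ((x *m M) 0 i)%:P + ((y *m M) 0 i) *: 'X) f.
have pE t : p.[t] = f.@[(x *m M + t *: (y *m M)) 0].
  rewrite horner_mmap; apply: meval_eq => i; rewrite !hornerE mulrC.
  by move: (x *m M) (y *m M) => x' y'; rewrite !mxE.
rewrite (dirder_horner pE); apply: dirder_horner => t.
by rewrite meval_precomp pE mulmxDl scalemxAl.
Qed.

Lemma tangent_mulmx X M x y : (forall z, X z -> X (z *m M)) ->
  tangent_cone_space X x y -> tangent_cone_space X (x *m M) (y *m M).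
Proof.
move=> XM xy d f fd fX; rewrite -/(dirder _ _ _) -dirder_precomp.
apply: (xy d); first exact: dhomog_precomp.
by move=> z Xz; rewrite meval_precomp; apply/fX/XM.
Qed.

Lemma tangent_line X x y : (forall t, X (x + t *: y)) -> tangent_cone_space X x y.
Proof.
move=> Xl d f fd fX; rewrite -/(dirder _ _ _) (@dirder_horner _ _ _ _ _ 0).
  by rewrite deriv0 horner0.
by move=> t; rewrite horner0 fX.
Qed.

Lemma tangent_cone_add X x y z :
  tangent_cone_space X x y -> tangent_cone_space X x z -> tangent_cone_space X x (y + z).
Proof.
move=> xy xz d f fd fX; transitivity (dirder f x y + dirder f x z).
  by rewrite -big_split; apply: eq_bigr => i _; rewrite mxE mulrDr.
by rewrite /dirder (xy d) // (xz d) // addr0.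
Qed.

Lemma tangent_cone_scale X x y (a : K) :
  tangent_cone_space X x y -> tangent_cone_space X x (a *: y).
Proof.
move=> xy d f fd fX; transitivity (a * dirder f x y).
  by rewrite mulr_sumr; apply: eq_bigr => i _; rewrite mxE mulrCA.
by rewrite /dirder (xy d) // mulr0.
Qed.

Lemma tangent_cone0 X x : tangent_cone_space X x 0.
Proof. by move=> d f fd fX; rewrite big1 // => i _; rewrite mxE mulr0. Qed.

(** Limits of polynomial curves: a form vanishing on [X] pulls back to a polynomial in one variable
    that is zero at every [t != 0]. *)
Lemma zariski_closure_curve X (c : 'I_N -> {poly K}) :
  (forall t, t != 0 -> X (\row_i (c i).[t])) -> (\row_i (c i).[0]) != 0 ->
  zariski_closure X (\row_i (c i).[0]).
Proof.
move=> Xc c0; split => // d f fd fX.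
rewrite (_ : _.@[_] = (mmap (@polyC K) c f).[0]); last first.
  by rewrite horner_mmap; apply: meval_eq => i; rewrite mxE.
rewrite [mmap _ _ _](_ : _ = 0) ?horner0 //; apply: poly_eq0_horner => t t0.
rewrite horner_mmap -(fX _ (Xc t t0)); apply: meval_eq => i; by rewrite mxE.
Qed.

Lemma zariski_closure_line X x y :
  (forall t, t != 0 -> X (x + t *: y)) -> x != 0 -> zariski_closure X x.
Proof.
pose c i : {poly K} := (x 0 i)%:P + y 0 i *: 'X.
have cE t : \row_i (c i).[t] = x + t *: y.
  by apply/rowP => i; rewrite !mxE !hornerE mulrC.
move=> Xl x0; have := @zariski_closure_curve X c; rewrite cE scale0r addr0; apply => //.
by move=> t t0; rewrite cE; apply: Xl.
Qed.

Lemma has_dim_uniq X d e : has_dim X d -> has_dim X e -> d = e.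
Proof. by move=> [dX Xd] [eX Xe]; apply/eqP; rewrite eqn_leq Xe ?Xd. Qed.

End LinearMaps.

(** Induction on the row. In entry (i, j) of the product of [A] and its inverse, terms before [i]
    vanish by induction and terms after it by triangularity of [A], leaving [A i i] times the wanted
    entry. *)
Lemma invmx_trig (K : fieldType) n (A : 'M[K]_n) : A \in unitmx ->
  is_trig_mx A -> is_trig_mx (invmx A).
Proof.
move=> Au /is_trig_mxP At.
have Ad i : A i i != 0.
  have : \det A != 0 by rewrite -unitfE -unitmxE.
  by rewrite det_trig; [move/prodf_neq0/(_ i isT)|apply/is_trig_mxP].
apply/is_trig_mxP => i j; elim/ltn_ind: {i}(i : nat) {-2}i (erefl (i : nat)) => m IHm i im ij.
have /matrixP/(_ i j) := mulmxV Au; rewrite !mxE (bigD1 i) //= big1 ?addr0.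
  rewrite -val_eqE ltn_eqF // => /eqP; rewrite mulf_eq0 (negbTE (Ad i)) /=.
  by move/eqP.
move=> k ki; case: (ltngtP k i) => [ki'|ik|/val_inj e]; last by rewrite e eqxx in ki.
  by rewrite (IHm k) ?mulr0 // -?im // (ltn_trans ki').
by rewrite At ?mul0r.
Qed.

Section Schubert.
Variables (K : numFieldType) (r n : nat).
Implicit Types (u v w t : minrep r n) (f : 'I_r -> 'I_n).
Local Notation N := #|{: minrep r n}|.
Local Notation pt := 'rV[K]_N.
Implicit Types (x y : pt) (A : 'M[K]_(n, r)) (b : 'M[K]_n).

Definition pcoord_poly f : {mpoly K[N]} :=
  \sum_(t : minrep r n) \det (mxsub f t (1%:M : 'M[K]_n)) *: 'X_(enum_rank t).

Lemma meval_pcoord_poly f x : (pcoord_poly f).@[x 0] = pcoord f x.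
Proof. by rewrite raddf_sum; apply: eq_bigr => t _ /=; rewrite mevalZ mevalXU. Qed.

Lemma dhomog_pcoord_poly f : pcoord_poly f \is 1.-homog.
Proof. exact: dhomog_linear. Qed.

Definition plucker_poly u f : {mpoly K[N]} :=
  pcoord_poly u ^+ r * pcoord_poly f -
  pcoord_poly u * \det (\matrix_(i < r, j < r) pcoord_poly (replace u j (f i))).

Lemma meval_plucker_poly u f x : (plucker_poly u f).@[x 0] = pcoord u x ^+ r * pcoord f x -
  pcoord u x * \det (\matrix_(i < r, j < r) pcoord (replace u j (f i)) x).
Proof.
rewrite mevalB !mevalM rmorphXn [X in X ^+ _]meval_pcoord_poly !meval_pcoord_poly -det_map_mx.
by congr (_ - _ * \det _); apply/matrixP => i j; rewrite !mxE -meval_pcoord_poly.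
Qed.

Lemma dhomog_plucker_poly u f : plucker_poly u f \is r.+1.-homog.
Proof.
apply: rpredB.
  rewrite -addn1 dhomogM ?dhomog_pcoord_poly // -[r in X in X.-homog]mul1n.
  exact: dhomogMn (dhomog_pcoord_poly u).
rewrite -add1n dhomogM ?dhomog_pcoord_poly //; apply: rpred_sum => s _.
rewrite rpredMsign.
suff: \prod_i (\matrix_(i < r, j < r) pcoord_poly (replace u j (f i))) i (s i)
  \is (\sum_(i < r) 1)%N.-homog by rewrite sum1_card card_ord.
by apply: dhomog_bigprod => i _; rewrite mxE dhomog_pcoord_poly.
Qed.

Lemma cell_neq0 u x : schubert_cell K u x -> x != 0.
Proof.
move=> /pcoord_cell_neq0 xu; apply/eqP => x0.
by move: xu; rewrite x0 -(scale0r 0) pcoordZ mul0r eqxx.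
Qed.

Lemma cell_sub_schubert u : schubert_cell K u `<=` schubert K u.
Proof. by apply: sub_zariski_closure => /cell_neq0; rewrite eqxx. Qed.

Lemma cell_scale u x (c : K) : c != 0 -> schubert_cell K u x -> schubert_cell K u (c *: x).
Proof.
move=> c0 [b [a [bB a0 ->]]]; exists b, (c * a).
by rewrite mulf_neq0 // scalerA.
Qed.

Lemma borelM b b' : borel b -> borel b' -> borel (b *m b').
Proof.
move=> [/is_trig_mxP bt b1] [/is_trig_mxP b't b'1]; split; last by rewrite det_mulmx b1 b'1 mulr1.
apply/is_trig_mxP => i j ij; rewrite !mxE big1 // => k _.
have := bt k j; have := b't i k; rewrite !mxE.
case: (ltnP k j) => [_ _ ->|jk ->]; rewrite ?mul0r ?mulr0 //.
exact: leq_trans ij jk.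
Qed.

Lemma borel_unit b : borel b -> b \in unitmx.
Proof. by case=> _ b1; rewrite unitmxE b1 unitr1. Qed.

Lemma borelV b : borel b -> borel (invmx b).
Proof.
move=> bB; have bu := borel_unit bB; case: bB => bt b1; split.
  by rewrite trmx_inv; apply: invmx_trig; rewrite ?unitmx_tr.
by rewrite det_inv b1 invr1.
Qed.

Lemma cell_act u x b : borel b -> schubert_cell K u x -> schubert_cell K u (wedge_act b x).
Proof.
move=> bB [b' [a [b'B a0 ->]]]; exists (b *m b'), a; split => //; first exact: borelM.
by rewrite wedge_mxE -scalemxAl -wedge_mxE wedge_actM.
Qed.

Lemma schubert_neq0 w x : schubert K w x -> x != 0.
Proof. by case. Qed.

Lemma schubert_closed w : zariski_closed (schubert K w).
Proof. exact: zariski_closure_closed. Qed.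

Lemma schubert_act w x b : borel b -> schubert K w x -> schubert K w (wedge_act b x).
Proof.
move=> bB; rewrite wedge_mxE /schubert.
apply: (zariski_closure_mulmx (M' := wedge_mx r (invmx b))).
  by rewrite wedge_mxM mulVmx ?wedge_mx1 // borel_unit.
by move=> z; rewrite -wedge_mxE; apply: cell_act.
Qed.

Lemma schubert_satisfies w x : schubert K w x -> satisfies_plucker x.
Proof.
move=> [_ xw] u f; apply/eqP; rewrite -subr_eq0 -meval_plucker_poly; apply/eqP.
apply: xw (dhomog_plucker_poly u f) _ => y /cell_satisfies yP.
by rewrite meval_plucker_poly yP subrr.
Qed.

Lemma schubert_coord w x t : schubert K w x -> pcoord t x != 0 -> brle t w.
Proof.
move=> [_ xw]; apply: contraNT => tw; rewrite -meval_pcoord_poly; apply/eqP.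
apply: xw (dhomog_pcoord_poly t) _ => y yw; rewrite meval_pcoord_poly.
by apply/eqP; apply: contraNT tw; apply: pcoord_cell_brle.
Qed.

Lemma schubert_sub_cells w x : schubert K w x ->
  exists u, [/\ brle u w, schubert_cell K u x & pcoord u x != 0].
Proof.
move=> xw; have [u xu uc] := satisfies_cell (schubert_neq0 xw) (schubert_satisfies xw).
by exists u; split => //; apply: schubert_coord xu.
Qed.

(** Only column [i] involves [a] and minors are linear in each column, so the line consists of
    decomposable vectors. *)
Lemma plucker_line u i (j : 'I_n) (a : K) :
  plucker (\matrix_(p < n, k < r) ((p == u k)%:R + (k == i)%:R * (a * (p == j)%:R)))
    = wedge K u + a *: wedge K (replace u i j).
Proof.
apply: pcoordP => t; rewrite pcoordD pcoordZ !pcoord_wedge pcoord_plucker.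
rewrite -[LHS]det_tr -[X in _ = X + _]det_tr -[X in _ = _ + _ * X]det_tr -[X in _ = X + _]mul1r.
have liftF k : (lift i k == i) = false by rewrite eq_sym (negbTE (neq_lift i k)).
apply: (@determinant_multilinear _ _ _ _ _ i).
- by apply/rowP => k; rewrite !mxE eqxx mul1r /replace eqxx mul1r.
- by apply/matrixP => k l; rewrite !mxE liftF mul0r addr0.
- by apply/matrixP => k l; rewrite !mxE /replace !liftF mul0r addr0.
Qed.

Lemma wedge_cell u : schubert_cell K u (wedge K u).
Proof.
exists 1%:M, 1; rewrite oner_eq0 scale1r wedge_act1 wedge_basisE.
by split => //; split; [exact: trig1|exact: det1].
Qed.

(** For [s != 0], [wedge K u + s *: wedge K u'] is a multiple of [wedge K u' + s^-1 *: wedge K u],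
    which has an echelon form with pivots [u']. Thus [wedge K u] is a limit of points of the cell of
    [u'], and the Borel group carries this over the cell of [u]. *)
Lemma cell_sub_schubert_step u u' i : (u i < u' i)%N -> u' =1 replace u i (u' i) ->
  schubert_cell K u `<=` schubert K u'.
Proof.
move=> ui u'E x xu; have x0 := cell_neq0 xu; have [b [c [bB c0 xE]]] := xu.
apply: (@zariski_closure_line _ _ _ _ (c *: wedge_act b (wedge K u'))) x0 => s s0.
rewrite xE wedge_basisE scalerA [s * c]mulrC -scalerA -scalerDr; apply: cell_scale => //.
rewrite !wedge_mxE scalemxAl -mulmxDl -wedge_mxE; apply: cell_act => //.
have -> : wedge K u + s *: wedge K u' = s *: (wedge K u' + s^-1 *: wedge K (replace u' i (u i))).
  rewrite scalerDr scalerA divff // scale1r addrC; congr (_ + _).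
  congr wedge; apply/funext => k; rewrite /replace; case: eqP => [->//|/eqP ki].
  by rewrite u'E /replace (negbTE ki).
rewrite -plucker_line; apply: echelon_cell => //; split=> [k l|k j kj]; rewrite !mxE.
  rewrite (inj_eq (@minrep_inj _ _ u')) (_ : (u' k == u i) = false) ?mulr0 ?addr0 //.
  rewrite u'E /replace; case: (eqVneq k i) => [_|ki].
    by rewrite -val_eqE gtn_eqF.
  by rewrite (inj_eq (@minrep_inj _ _ u)) (negbTE ki).
rewrite -val_eqE gtn_eqF // add0r; case: eqP => [ki|]; last by rewrite mul0r.
by rewrite -val_eqE gtn_eqF ?mulr0 // (ltn_trans ui) // -ki.
Qed.

End Schubert.

(** * Schubert varieties *)

Section Schubert2.
Variables (K : numFieldType) (r n : nat).
Implicit Types (u v w t : minrep r n) (f : 'I_r -> 'I_n).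
Local Notation N := #|{: minrep r n}|.
Local Notation pt := 'rV[K]_N.
Implicit Types (x y : pt) (A : 'M[K]_(n, r)) (b : 'M[K]_n).

Lemma cell_sub_schubert_le u w : brle u w -> schubert_cell K u `<=` schubert K w.
Proof.
have [m] := ubnP (\sum_i w i - \sum_i u i); elim: m u => // m IHm u lem uw.
have [<-|nuw] := eqVneq u w; first exact: cell_sub_schubert.
have [u' [i [ui u'E u'w]]] := brle_step uw nuw.
have Hu' : schubert K u' `<=` schubert K w.
  apply: zariski_closure_min; first exact: schubert_closed.
  apply: IHm => //; rewrite -ltnS; apply: leq_trans lem; rewrite ltnS.
  have lt : (\sum_i u i < \sum_i u' i)%N.
    rewrite (bigD1 i) //= [X in (_ < X)%N](bigD1 i) //= -addSn leq_add //.
    rewrite leq_sum // => k /negbTE ki.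
    by rewrite u'E /replace ki.
  have : (\sum_i u' i <= \sum_i w i)%N by apply: leq_sum => k _; apply/forallP: k.
  by move=> h; apply: ltn_sub2l => //; apply: leq_trans lt h.
by move=> x /(cell_sub_schubert_step ui u'E); apply: Hu'.
Qed.

Lemma schubert_sub u w : brle u w -> schubert K u `<=` schubert K w.
Proof.
move=> uw; apply: zariski_closure_min; first exact: schubert_closed.
exact: cell_sub_schubert_le.
Qed.

(** The Plucker relations place [x] in a cell whose index is itself a nonzero coordinate of [x],
    hence below [w]. *)
Lemma schubert_criterion w x : x != 0 -> satisfies_plucker x ->
  (forall t, pcoord t x != 0 -> brle t w) -> schubert K w x.
Proof.
move=> x0 xP xw; have [u xu uc] := satisfies_cell x0 xP.
exact: cell_sub_schubert_le (xw u xu) _ uc.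
Qed.

Lemma schubert_cell_point w : schubert K w (wedge K w).
Proof. exact/cell_sub_schubert/wedge_cell. Qed.

Lemma curve_plucker (c : 'I_n -> 'I_r -> {poly K}) s :
  \row_i (\det (\matrix_(k, l) c ((enum_val i : minrep r n) k) l)).[s] =
  plucker (\matrix_(j, l) (c j l).[s]).
Proof.
apply/rowP => i; rewrite !mxE -horner_evalE -det_map_mx; congr (\det _).
by apply/matrixP => k l; rewrite !mxE.
Qed.

(* Two points of the cell are joined by an affine line of echelon matrices, on
   which a product of two nonzero polynomials does not vanish identically. *)
Lemma schubert_irreducible w : irreducible_closed (schubert K w).
Proof.
split; [exact: schubert_closed|by exists (wedge K w); apply: schubert_cell_point|].
move=> Y1 Y2 Y1c Y2c XY; apply: contrapT => /not_orP[nY1 nY2].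
have key Y : zariski_closed Y -> ~ schubert K w `<=` Y ->
    exists d g A, [/\ g \is d.-homog, vanishes_on Y g, echelon w A & g.@[(plucker A) 0] != 0].
  move=> Yc nY; apply: contra_notP nY => ng; apply: zariski_closure_min => // x xw.
  rewrite -Yc; split; first exact: cell_neq0 xw.
  move=> d g gd gY; apply: contrapT => gx; apply: ng.
  have [A [c [c0 wA xE]]] := cell_echelon xw; exists d, g, A; split => //.
  by move/eqP: gx; rewrite xE (dhomog_meval _ _ gd) mulf_eq0 negb_or => /andP[].
have [d1 [g1 [A1 [g1d g1Y [A11 A10] g1A]]]] := key _ Y1c nY1.
have [d2 [g2 [A2 [g2d g2Y [A21 A20] g2A]]]] := key _ Y2c nY2.
pose c j l : {poly K} := (A1 j l)%:P + (A2 j l - A1 j l) *: 'X.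
pose As s := \matrix_(j, l) (c j l).[s].
have AsE s j l : As s j l = A1 j l + (A2 j l - A1 j l) * s by rewrite mxE /c !hornerE.
have As0 : As 0 = A1 by apply/matrixP => j l; rewrite AsE mulr0 addr0.
have As1 : As 1 = A2 by apply/matrixP => j l; rewrite AsE mulr1 addrC subrK.
have Asw s : echelon w (As s).
  split=> [i k|i j ij]; rewrite AsE.
    by rewrite A11 A21 subrr mul0r addr0.
  by rewrite A10 // A20 // subrr mul0r addr0.
pose D (i : 'I_N) := \det (\matrix_(k, l) c ((enum_val i : minrep r n) k) l).
pose p g := mmap (@polyC K) D g.
have pE g s : (p g).[s] = g.@[(plucker (As s)) 0].
  rewrite horner_mmap -curve_plucker; apply: meval_eq => i.
  by rewrite [RHS]mxE.
have : p g1 * p g2 != 0.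
  rewrite mulf_neq0 //; apply/eqP => p0.
    by move: g1A; rewrite -As0 -pE p0 horner0 eqxx.
  by move: g2A; rewrite -As1 -pE p0 horner0 eqxx.
case/eqP; apply: poly_eq0_horner => s _; rewrite hornerM !pE.
have xw : schubert K w (plucker (As s)).
  rewrite -[plucker _]scale1r; apply/cell_sub_schubert/echelon_cell => //.
  exact: oner_neq0.
by have [/g1Y ->|/g2Y ->] := XY _ xw; rewrite ?mul0r ?mulr0.
Qed.

(** * Dimension of Schubert varieties *)

Definition echelon_support w : {set 'I_n * 'I_r} :=
  [set p | (p.1 \notin codom w) && (p.1 <= w p.2)%N].

Lemma card_echelon_support w : #|echelon_support w| = minrep_length w.
Proof.
transitivity (\sum_(i < r) #|[set j : 'I_n | (j \notin codom w) && (j <= w i)%N]%SET|)%N.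
  transitivity (\sum_(i < r) \sum_(j < n) ((j \notin codom w) && (j <= w i)%N))%N.
    rewrite exchange_big pair_big -sum1_card [LHS]big_mkcond /=; apply: eq_bigr => -[i j] _.
    by rewrite inE /=; case: ifP.
  apply: eq_bigr => i _; rewrite -sum1_card [RHS]big_mkcond /=.
  by apply: eq_bigr => j _; rewrite inE; case: ifP.
apply: eq_bigr => i _; rewrite card_notin_le.
suff -> : count_le w (w i) = i.+1 by rewrite subSS.
by rewrite -(card_ord_le i); apply: eq_card => k; rewrite !inE minrep_leE.
Qed.

(** Generic echelon matrix: 1 at the pivots, one variable at each free position, 0 elsewhere. *)
Definition echelon_entry w (j : 'I_n) (i : 'I_r) : {mpoly K[#|echelon_support w|]} :=
  ((j == w i)%:R)%:MP + \sum_q (enum_val q == (j, i))%:R *: 'X_q.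

Lemma echelon_parametrization w A : echelon w A ->
  exists s, forall j i, (echelon_entry w j i).@[s] = A j i.
Proof.
move=> [A1 A0]; exists (fun q => A (enum_val q).1 (enum_val q).2) => j i.
rewrite mevalD mevalC raddf_sum /=.
rewrite (eq_bigr (fun q =>
  (enum_val q == (j, i))%:R * A (enum_val q).1 (enum_val q).2)); last first.
  by move=> q _; rewrite mevalZ mevalXU.
rewrite -(big_enum_val (fun p => (p == (j, i))%:R * A p.1 p.2)) /=.
have [/codomP[k ->]|jw] := boolP (j \in codom w).
  rewrite A1 (inj_eq (@minrep_inj _ _ w)) big1 ?addr0 // => p.
  by rewrite inE; case: eqP => [->|]; rewrite ?mul0r //= codom_f.
rewrite (_ : (j == w i) = false) ?add0r; last first.
  by apply: contraNF jw => /eqP ->; apply: codom_f.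
case: (leqP j (w i)) => ji.
  rewrite (bigD1 (j, i)) ?inE /= ?jw // eqxx mul1r big1 ?addr0 // => p /andP[_ /negbTE ->].
  by rewrite mul0r.
rewrite A0 // big1 // => p; rewrite inE; case: eqP => [->|]; rewrite ?mul0r //=.
by rewrite [(j <= _)%N]leqNgt ji andbF.
Qed.

(** Each lowering of one entry of [w] costs one unit of length, and [wedge K w] lies in X(w) but not
    in the smaller variety. *)
Lemma irreducible_chain_schubert w : irreducible_chain (schubert K w) (minrep_length w).
Proof.
suff [Z [Zirr Zlt ZE]] : exists Z : nat -> set pt,
  [/\ forall i, (i <= minrep_length w)%N -> irreducible_closed (Z i),
      forall i, (i < minrep_length w)%N -> Z i `<` Z i.+1 &
      Z (minrep_length w) = schubert K w].
  exists Z; split => // i iw; split; first exact: Zirr.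
  rewrite -ZE; elim: (minrep_length w) i iw Zlt {Zirr ZE} => [|m IHm] i.
    by rewrite leqn0 => /eqP -> _ x.
  rewrite leq_eqVlt => /predU1P[-> _ x //|]; rewrite ltnS => im Zlt.
  apply: subset_trans (IHm i im _) (Zlt m _).1 => //.
  by move=> k km; apply: Zlt; rewrite ltnW.
elim: {w}(minrep_length w) {-2}w (erefl (minrep_length w)) => [|m IHm] w wm.
  exists (fun=> schubert K w); split => [i _|i|//]; first exact: schubert_irreducible.
  by rewrite wm ltn0.
have [|u [i [ui wE]]] := @minrep_length_step r n w; first by rewrite wm.
rewrite wm => -[/esym um]; have [Z []] := IHm u um; rewrite um => Zirr Zlt Zm.
have uw : brle u w.
  apply/forallP => k; have [->|ki] := eqVneq k i; first exact: ltnW.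
  by rewrite wE /replace (negbTE ki).
exists (fun k => if (k <= m)%N then Z k else schubert K w); split.
- by move=> k _; case: ifP => [/Zirr//|_]; exact: schubert_irreducible.
- move=> k; rewrite ltnS => km; rewrite km; case: ltnP => [/Zlt //|mk].
  have -> : k = m by apply/eqP; rewrite eqn_leq km.
  rewrite Zm; split; first exact: schubert_sub.
  move=> wu; have := schubert_coord (t := w) (wu _ (schubert_cell_point w)).
  rewrite pcoord_wedge det_mxsub1 eqxx oner_eq0 => /(_ isT) /forallP /(_ i).
  by rewrite leqNgt ui.
- by rewrite ltnn.
Qed.

Lemma has_dim_schubert w : has_dim (schubert K w) (minrep_length w).
Proof.
split; first exact: irreducible_chain_schubert.
rewrite -card_echelon_support => e.
pose F (i : 'I_N) : {mpoly K[#|echelon_support w|]} :=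
  \det (\matrix_(k, l) echelon_entry w ((enum_val i : minrep r n) k) l).
apply: (@dim_le_parameters _ _ _ _ F) => d f fd f0.
apply: (vanishes_on_closure fd) => x xw.
have [A [c [c0 wA ->]]] := cell_echelon xw.
rewrite (dhomog_meval _ _ fd); have [s sA] := echelon_parametrization wA.
have -> : f.@[plucker A 0] = f.@[fun i => (F i).@[s]].
  apply: meval_eq => i; rewrite mxE -det_map_mx; congr (\det _).
  by apply/matrixP => k l; rewrite !mxE -sA.
by rewrite f0 mulr0.
Qed.

End Schubert2.

(** * Tangent spaces of Schubert varieties *)

Section Tangent.
Variables (K : numFieldType) (r n : nat).
Implicit Types (u v w t : minrep r n) (f : 'I_r -> 'I_n).
Local Notation N := #|{: minrep r n}|.
Local Notation pt := 'rV[K]_N.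
Implicit Types (x y : pt) (A : 'M[K]_(n, r)) (b : 'M[K]_n).

Lemma tangent_self (X : set pt) x : X x -> tangent_cone_space X x x.
Proof.
move=> Xx d f fd fX; rewrite -/(dirder _ _ _) (@dirder_horner _ _ _ _ _ 0).
  by rewrite deriv0 horner0.
by move=> s; rewrite horner0 -{1}[x]scale1r -scalerDl (dhomog_meval _ _ fd) fX ?mulr0.
Qed.

(** The index [u] itself accounts for the radial direction, matching the [d.+1] in
    [smooth_locus]. *)
Definition tangent_index u w : {set minrep r n} :=
  (u |: [set exchange u p.1 p.2 | p in exchanges u w])%SET.

Lemma card_tangent_index u w : #|tangent_index u w| = #|exchanges u w|.+1.
Proof.
rewrite cardsU1 card_in_imset; last first.
  move=> [i x] [j y]; rewrite !inE /= => /andP[xu _] /andP[yu _].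
  exact: exchange_inj.
case: imsetP => // -[[i x]]; rewrite inE /= => /andP[xu _] ue.
by have := exchange_neq i xu; rewrite -ue eqxx.
Qed.

Lemma pcoord_sum t (I : Type) (s : seq I) (P : pred I) (F : I -> pt) :
  pcoord t (\sum_(i <- s | P i) F i) = \sum_(i <- s | P i) pcoord t (F i).
Proof.
apply: (big_morph (pcoord t)); first exact: pcoordD.
by rewrite -(scale0r 0) pcoordZ mul0r.
Qed.

Lemma wedge_expand y (T : {set minrep r n}) : (forall t, t \notin T -> pcoord t y = 0) ->
  y = \sum_(t in T) pcoord (t : minrep r n) y *: wedge K (t : minrep r n).
Proof.
move=> yT; apply: pcoordP => t; rewrite pcoord_sum.
under eq_bigr do rewrite pcoordZ pcoord_wedge det_mxsub1.
have [tT|tT] := boolP (t \in T).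
  rewrite (bigD1 t) //= eqxx mulr1 big1 ?addr0 // => s /andP[_ /negbTE st].
  by rewrite eq_sym st mulr0.
rewrite yT // big1 // => s sT; case: eqP => [e|]; last by rewrite mulr0.
by rewrite e sT in tT.
Qed.

(** For an exchange, the whole line from [wedge K u] in that direction lies in X(w): it is
    decomposable and its nonzero coordinates are among [u] and the exchange. *)
Lemma tangent_index_sub u w t : brle u w -> t \in tangent_index u w ->
  tangent_cone_space (schubert K w) (wedge K u) (wedge K t).
Proof.
move=> uw; rewrite !inE => /predU1P[->|/imsetP[[i x]]].
  by apply/tangent_self/(schubert_sub uw)/schubert_cell_point.
rewrite inE /= => /andP[xu ew] ->.
have [s es] := exchangeP i xu.
have wE : wedge K (exchange u i x) = (-1) ^+ s *: wedge K (replace u i x).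
  by rewrite (_ : replace _ _ _ = exchange u i x \o s) ?wedge_perm ?signrZK //; apply/funext.
rewrite wE; apply/tangent_cone_scale/tangent_line => c.
have pc t' : pcoord t' (wedge K u + c *: wedge K (replace u i x)) =
    (t' == u)%:R + c * ((-1) ^+ s * (t' == exchange u i x)%:R).
  rewrite pcoordD pcoordZ !pcoord_wedge det_mxsub1 -pcoord_wedge.
  by rewrite -[wedge K (replace _ _ _)](signrZK s) -wE pcoordZ pcoord_wedge det_mxsub1.
apply: schubert_criterion.
- apply/eqP => /(congr1 (pcoord u)); rewrite pc eqxx eq_sym (negbTE (exchange_neq i xu)).
  rewrite !mulr0 addr0 -[0 in RHS](scale0r 0) pcoordZ mul0r => /eqP.
  by rewrite oner_eq0.
- by rewrite -plucker_line; apply: plucker_satisfies.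
- move=> t'; rewrite pc; case: (eqVneq t' u) => [->//|_].
  by case: (eqVneq t' _) => [->//|_]; rewrite !mulr0 addr0 eqxx.
Qed.

Lemma pcoord_replace_wedge u j (a : 'I_n) : a \notin codom u ->
  pcoord (replace u j a) (wedge K u) = 0.
Proof.
move=> au; rewrite pcoord_plucker (expand_det_row _ j) big1 // => k _.
rewrite !mxE /replace eqxx (_ : (a == u k) = false) ?mul0r //.
by apply: contraNF au => /eqP ->; apply: codom_f.
Qed.

(* Two rows of the determinant in [plucker_poly u t] vanish at [wedge u], so the
   determinant vanishes there to second order. *)
Lemma tangent_wedge_plucker u t y i1 i2 : i1 != i2 ->
  t i1 \notin codom u -> t i2 \notin codom u -> t != u ->
  dirder (plucker_poly K u t) (wedge K u) y = pcoord t y.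
Proof.
move=> i12 ti1 ti2 tu.
pose L f : {poly K} := (pcoord f (wedge K u))%:P + pcoord f y *: 'X.
have LE f s : (L f).[s] = pcoord f (wedge K u + s *: y).
  by rewrite /L !hornerE pcoordD pcoordZ mulrC.
pose C := \matrix_(i < r, j < r) L (replace u j (t i)).
pose inner (i : 'I_r) := (i == i1) || (i == i2).
pose D := \row_(i < r) (if inner i then 'X else 1 : {poly K}).
pose C' := \matrix_(i < r, j < r)
  if inner i then (pcoord (replace u j (t i)) y)%:P else L (replace u j (t i)).
have CE : C = diag_mx D *m C'.
  apply/matrixP => i j; rewrite mul_diag_mx !mxE; case: ifP => [ii|_]; last by rewrite mul1r.
  rewrite /L pcoord_replace_wedge ?add0r; first by rewrite -mul_polyC mulrC.
  by case/orP: ii => /eqP ->.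
have detC : \det C = 'X * ('X * \det C').
  rewrite CE det_mulmx det_diag (bigD1 i1) //= (bigD1 i2) 1?eq_sym //= big1.
    by rewrite !mxE /inner !eqxx orbT mulr1 mulrA.
  by move=> i /andP[/negbTE ni1 /negbTE ni2]; rewrite mxE /inner ni1 ni2.
pose q := L u ^+ r * (pcoord t y)%:P - L u * ('X * \det C').
rewrite (@dirder_horner _ _ _ _ _ ('X * q)).
  rewrite derivM derivX mul1r /q !hornerE /= pcoord_wedge det_mxsub1 eqxx.
  by rewrite expr1n mul1r mulr0 mul0r subr0.
move=> s; rewrite meval_plucker_poly -!LE.
have -> : \det (\matrix_(i, j) pcoord (replace u j (t i)) (wedge K u + s *: y)) = (\det C).[s].
  rewrite -horner_evalE -det_map_mx; congr (\det _); apply/matrixP => i j.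
  by rewrite !mxE -LE.
rewrite detC /q !hornerE /= [pcoord t (wedge K u)]pcoord_wedge det_mxsub1 (negbTE tu) add0r.
ring.
Qed.

Lemma dirder_pcoord t x y : dirder (pcoord_poly K t) x y = pcoord t y.
Proof.
rewrite (@dirder_horner _ _ _ _ _ ((pcoord t x)%:P + pcoord t y *: 'X)).
  by rewrite derivD derivC derivZ derivX !hornerE.
by move=> s; rewrite meval_pcoord_poly pcoordD pcoordZ !hornerE mulrC.
Qed.

(** If [t] is not below [w], coordinate [t] itself vanishes on X(w). Otherwise [t] has two values
    outside [u], and the differential of its Plucker relation at [wedge K u] is coordinate [t]. *)
Lemma tangent_wedge u w y t : tangent_cone_space (schubert K w) (wedge K u) y ->
  t \notin tangent_index u w -> pcoord t y = 0.
Proof.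
move=> uy tT; have [tw|tw] := boolP (brle t w); last first.
  rewrite -(dirder_pcoord t (wedge K u)); apply: uy (dhomog_pcoord_poly K t) _ => x xw.
  by rewrite meval_pcoord_poly; apply/eqP; apply: contraNT tw; apply: schubert_coord.
have tu : t != u by apply: contraNneq tT => ->; rewrite !inE eqxx.
have [i x xu|i1 [i2 [i12 ti1 ti2]]] := minrep_two_outside tu.
  apply: contraNneq tT => te; rewrite !inE; apply/orP; right.
  by apply/imsetP; exists (i, x); rewrite // inE /= xu -te.
rewrite -(tangent_wedge_plucker (u := u) y i12) //.
apply: uy (dhomog_plucker_poly K u t) _ => x xw.
by rewrite meval_plucker_poly (schubert_satisfies xw) subrr.
Qed.

(** The invertible matrix [M], a scaled Borel element, carries [wedge K u] to [x] and preserves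
    X(w), as does its inverse; so it transports the basis of the tangent space. *)
Lemma tangent_dim u w x : brle u w -> schubert_cell K u x ->
  exists2 U : {vspace pt}, tangent_cone_space (schubert K w) x = [set y | y \in U]
    & \dim U = #|exchanges u w|.+1.
Proof.
move=> uw [b [c [bB c0 xE]]].
pose M := c *: wedge_mx r b; pose M' := c^-1 *: wedge_mx r (invmx b).
have bu := borel_unit bB.
have MM' : M *m M' = 1%:M.
  by rewrite -scalemxAl -scalemxAr scalerA divff // scale1r wedge_mxM mulVmx ?wedge_mx1.
have M'M : M' *m M = 1%:M.
  by rewrite -scalemxAl -scalemxAr scalerA mulVf // scale1r wedge_mxM mulmxV ?wedge_mx1.
have XM z : schubert K w z -> schubert K w (z *m M).
  move=> zw; rewrite -scalemxAr -wedge_mxE.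
  by apply: zariski_closed_scale c0 (schubert_act bB zw); apply: schubert_closed.
have XM' z : schubert K w z -> schubert K w (z *m M').
  move=> zw; rewrite -scalemxAr -wedge_mxE.
  apply: zariski_closed_scale (invr_neq0 c0) (schubert_act (borelV bB) zw).
  exact: schubert_closed.
have {}xE : x = wedge K u *m M by rewrite xE -scalemxAr -wedge_mxE wedge_basisE.
have [B BE] : exists B : #|tangent_index u w|.-tuple pt,
    forall i : 'I_#|tangent_index u w|, B`_i = wedge K (enum_val i : minrep r n) *m M.
  exists [tuple wedge K (enum_val i : minrep r n) *m M | i < #|tangent_index u w|].
  by move=> i; rewrite -tnth_nth tnth_mktuple.
have Bfree : free B.
  apply/freeP => k kB i.
  have : pcoord (enum_val i : minrep r n) ((\sum_i k i *: B`_i) *m M') = k i.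
    rewrite mulmx_suml pcoord_sum (bigD1 i) //= big1 => [|j ji].
      by rewrite BE -scalemxAl -mulmxA MM' mulmx1 pcoordZ pcoord_wedge det_mxsub1 eqxx mulr1 addr0.
    rewrite BE -scalemxAl -mulmxA MM' mulmx1 pcoordZ pcoord_wedge det_mxsub1.
    by rewrite (inj_eq enum_val_inj) eq_sym (negbTE ji) mulr0.
  by rewrite kB mul0mx -(scale0r 0) pcoordZ mul0r => <-.
exists <<B>>%VS; last by have /eqP -> := Bfree; rewrite size_tuple card_tangent_index.
apply/seteqP; split => y /=.
  move=> /(tangent_mulmx XM'); rewrite xE -mulmxA MM' mulmx1 => uy.
  have yE := wedge_expand (fun t => tangent_wedge uy (t := t)).
  rewrite -[y]mulmx1 -M'M mulmxA yE mulmx_suml; apply: memv_suml => t tT.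
  rewrite -scalemxAl memvZ // memv_span //.
  have -> : wedge K (t : minrep r n) *m M = B`_(enum_rank_in tT t) by rewrite BE enum_rankK_in.
  by rewrite mem_nth // size_tuple.
move=> /coord_span ->.
elim/big_ind: _ => [|y1 y2|i _]; [exact: tangent_cone0|exact: tangent_cone_add|].
apply: tangent_cone_scale; rewrite BE xE; apply: tangent_mulmx => //.
by apply: tangent_index_sub => //; apply: enum_valP.
Qed.

Lemma smooth_cell u w x : brle u w -> schubert_cell K u x ->
  smooth_locus (schubert K w) x <-> #|exchanges u w| = minrep_length w.
Proof.
move=> uw ux; have [U TU dU] := tangent_dim uw ux; split.
  move=> [_ [d [U' [dimd TU' dU']]]].
  have UU' : U = U'.
    apply/vspaceP => y; apply/idP/idP => yU.
      by have : [set y | y \in U'] y by rewrite -TU' TU.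
    by have : [set y | y \in U] y by rewrite -TU TU'.
  have ed := has_dim_uniq dimd (has_dim_schubert K w).
  by move: dU; rewrite UU' dU' ed => -[].
move=> e; split; first exact: cell_sub_schubert_le uw _ ux.
exists (minrep_length w), U; split => //; first exact: has_dim_schubert.
by rewrite dU e.
Qed.

End Tangent.

(** * Semistability *)

Lemma prod_blocks (R : comNzRingType) (a b : nat) (H : nat -> R) :
  \prod_(i < a) \prod_(k < b) H (i * b + k)%N = \prod_(p < a * b) H p.
Proof.
elim: a => [|a IHa]; first by rewrite mul0n !big_ord0.
by rewrite big_ord_recr IHa mulSnr big_split_ord.
Qed.

Lemma prod_if_const (R : comNzRingType) (I : finType) (P : pred I) (a b : R) :
  \prod_i (if P i then a else b) = a ^+ #|P| * b ^+ (#|I| - #|P|).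
Proof.
rewrite (bigID P) /= (eq_bigr (fun=> a)) => [|i ->] //.
rewrite prodr_const [X in _ * X](eq_bigr (fun=> b)) => [|i /negbTE -> //].
by rewrite prodr_const -(cardC P) addKn.
Qed.

Section Semistability.
Variables (K : numFieldType) (r n : nat).
Implicit Types (u v w t : minrep r n).
Local Notation N := #|{: minrep r n}|.
Local Notation pt := 'rV[K]_N.
Implicit Types (x y : pt).

Lemma torus_borel (d : 'M[K]_n) : torus d -> borel d.
Proof. by case; rewrite is_diag_mxEtrig => /andP[]. Qed.

Lemma pcoord_torus (d : 'M[K]_n) t x : torus d ->
  pcoord t (wedge_act d x) = (\prod_i d (t i) (t i)) * pcoord t x.
Proof.
move=> [dd _]; have := dd; rewrite is_diag_mxEtrig => /andP[dt dT].
rewrite pcoord_act (bigD1 t) //= big1 ?addr0 => [|u ut].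
  congr (_ * _); rewrite det_trig; first by apply: eq_bigr => i _; rewrite mxE.
  by apply/is_trig_mxP => i j ij; rewrite mxE (is_trig_mxP dt) // minrep_ltE.
case: (eqVneq (\det (mxsub t (u : minrep r n) d)) 0) => [->|d0]; first by rewrite mul0r.
case/eqP: ut; apply: brle_anti; last exact: upper_minor_brle dT d0.
apply: (@upper_minor_brle _ _ _ d^T); first by rewrite trmxK.
by rewrite -trmx_mxsub det_tr.
Qed.

(** Weight [n - q] on the first [q] basis vectors and [-q] on the others; the total q (n - q) - (n -
    q) q is zero, so the determinant is 1. *)
Definition one_ps (q : nat) (c : K) : 'M[K]_n :=
  diag_mx (\row_(j < n) if (j < q)%N then c ^+ (n - q) else (c ^+ q)^-1).

Lemma card_ord_ltn m q : (q <= m)%N -> #|[pred j : 'I_m | (j < q)%N]| = q.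
Proof.
move=> qm; rewrite -sum1_card -[RHS]card_ord -sum1_card.
by rewrite (big_ord_widen_cond m predT (fun=> 1%N) qm).
Qed.

Lemma torus_one_ps q c : (q <= n)%N -> c != 0 -> torus (one_ps q c).
Proof.
move=> qn c0; split; first exact: diag_mx_is_diag.
rewrite det_diag; under eq_bigr do rewrite mxE.
rewrite (prod_if_const (fun j : 'I_n => (j < q)%N)) card_ord_ltn // card_ord.
by rewrite exprVn -!exprM mulnC divff // expf_neq0.
Qed.

(** With Q = q + 1 and k entries of [t] at most [q], the weight is (n - Q) k - Q (r - k) = n k - r
    Q; the last hypothesis makes the truncated subtraction exact. *)
Lemma pcoord_one_ps q c t x : (q < n)%N -> c != 0 -> (r * q.+1 <= n * count_le t q)%N ->
  pcoord t (wedge_act (one_ps q.+1 c) x) = c ^+ (n * count_le t q - r * q.+1) * pcoord t x.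
Proof.
move=> qn c0 le; rewrite pcoord_torus; last exact: torus_one_ps.
congr (_ * _); transitivity (\prod_k (if (t k <= q)%N then c ^+ (n - q.+1) else (c ^+ q.+1)^-1)).
  by apply: eq_bigr => k _; rewrite !mxE eqxx ltnS.
rewrite (prod_if_const (fun k => (t k <= q)%N)) card_ord.
have -> : #|(fun k => (t k <= q)%N)| = count_le t q by rewrite /count_le cardsE.
have cr := count_le_max t q.
apply: (mulIf (_ : (c ^+ q.+1) ^+ (r - count_le t q) != 0)); first by rewrite !expf_neq0.
rewrite -mulrA -exprMn mulVf ?expf_neq0 // expr1n mulr1 -!exprM -exprD.
by congr (c ^+ _); nia.
Qed.

(* If [n * i.+1 > r * (u i).+1], a one-parameter subgroup acts on every point of
   [X(u)] with positive weights only.  Along its limit [0] in the affine cone an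
   invariant section of positive degree, locally a quotient [f / g], is both
   constant and divisible by the parameter. *)
Lemma semistable_bound u (i : 'I_r) : semistable K u !=set0 -> (n * i.+1 <= r * (u i).+1)%N.
Proof.
move=> [x [xu [m [s [m0 sec inv sx]]]]]; rewrite leqNgt; apply/negP => lt.
pose q := u i : nat; have qn : (q < n)%N := ltn_ord (u i).
pose e t := (n * count_le t q - r * q.+1)%N.
have ePos t : pcoord t x != 0 -> (r * q.+1 < n * count_le t q)%N.
  move=> /(schubert_coord xu)/forallP/(_ i); rewrite -count_le_ltE => h.
  by apply: leq_trans lt _; rewrite leq_mul2l h orbT.
have [t1 t1x] := pcoord_neq0 (schubert_neq0 xu).
have [t0 t0x t0min] : exists2 t0 : minrep r n, pcoord t0 x != 0 &
    forall t : minrep r n, pcoord t x != 0 -> (e t0 <= e t)%N.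
  by case: (@arg_minnP _ t1 (fun t => pcoord t x != 0) e t1x) => t; exists t.
pose a := e t0.
have a0 : (0 < a)%N by rewrite subn_gt0 ePos.
(* Dividing by the least weight [a] extends the orbit curve to parameter 0 with a nonzero value
   there. The exponent is truncated only on zero coordinates of [x]. *)
pose c (k : 'I_N) : {poly K} := (x 0 k) *: 'X^(e (enum_val k) - a).
pose z (p : K) : pt := \row_k (c k).[p].
have zE (p : K) : p != 0 -> wedge_act (one_ps q.+1 p) x = p ^+ a *: z p.
  move=> p0; apply: pcoordP => t; rewrite pcoordZ [pcoord t (z p)]pcoord_minrep.
  rewrite mxE /c enum_rankK !hornerE -pcoord_minrep.
  case: (eqVneq (pcoord t x) 0) => [tx0|tx].
    by rewrite pcoord_torus ?tx0 /= ?mulr0 ?mul0r //; apply: torus_one_ps.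
  rewrite pcoord_one_ps //; last by rewrite ltnW // ePos.
  by rewrite /= mulrAC -exprD subnKC ?t0min.
have zu (p : K) : p != 0 -> schubert K u (z p).
  move=> p0; have -> : z p = (p ^+ a)^-1 *: wedge_act (one_ps q.+1 p) x.
    by rewrite zE // scalerA mulVf ?scale1r // expf_neq0.
  apply: zariski_closed_scale; [exact: schubert_closed|by rewrite invr_neq0 // expf_neq0|].
  by apply: schubert_act xu; apply/torus_borel/torus_one_ps.
have z0 : schubert K u (z 0).
  rewrite -(schubert_closed K u); apply: zariski_closure_curve => //.
  apply/rV0Pn; exists (enum_rank t0); rewrite mxE /c enum_rankK subnn expr0 !hornerE.
  by rewrite -pcoord_minrep.
have [d [f [g [fd gd gz sE]]]] := sec _ z0.
pose F := mmap (@polyC K) c f; pose G := mmap (@polyC K) c g.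
have evE h (p : K) : (mmap (@polyC K) c h).[p] = h.@[(z p) 0].
  by rewrite horner_mmap; apply: meval_eq => k; rewrite mxE.
have G0 : G.[0] != 0 by rewrite evE.
(* Invariance gives [s x = p ^+ (a * m) * F.[p] / G.[p]] wherever [G.[p]] is nonzero; the outer
   factor [G] covers its roots. Since [G.[0]] is nonzero, [G] cancels and evaluation at 0
   contradicts [s x != 0]. *)
have : G * (s x *: G - 'X^(a * m) * F) = 0.
  apply: poly_eq0_horner => p p0; rewrite !hornerE -/F.
  have [->|Gp] := eqVneq G.[p] 0; first by rewrite mul0r.
  apply/eqP; rewrite mulf_eq0; apply/orP; right; rewrite subr_eq0; apply/eqP.
  have gl : g.@[(wedge_act (one_ps q.+1 p) x) 0] = p ^+ (a * d) * G.[p].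
    by rewrite zE // (dhomog_meval _ _ gd) -exprM -evE.
  have fl : f.@[(wedge_act (one_ps q.+1 p) x) 0] = p ^+ (a * (d + m)) * F.[p].
    by rewrite zE // (dhomog_meval _ _ fd) -exprM -evE.
  rewrite -(inv (one_ps q.+1 p)) //; last exact: torus_one_ps.
  rewrite sE; last first.
  - by rewrite gl mulf_neq0 // expf_neq0.
  - by apply: schubert_act xu; apply/torus_borel/torus_one_ps.
  rewrite gl fl mulnDr exprD; field.
  by rewrite Gp expf_neq0.
move/eqP; rewrite mulf_eq0 => /orP[/eqP G00|/eqP H].
  by rewrite G00 horner0 eqxx in G0.
have := congr1 (horner^~ 0) H; rewrite !hornerE expr0n muln_eq0 -!leqn0 leqNgt a0 leqNgt m0 /=.
by rewrite mul0r subr0 => /eqP; rewrite mulf_eq0 (negbTE sx) (negbTE G0).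
Qed.

Lemma homogeneous_section (X : set pt) m f : f \is m.-homog ->
  is_section X m (fun x => f.@[x 0]).
Proof.
move=> fm x _; exists 0%N, f, 1; split=> [|||y _ _]; rewrite ?meval1 ?divr1 //.
- exact: dhomog1.
- exact: oner_neq0.
Qed.

(* The [k]-th column of the tableau with [r] rows and [n] columns whose rows, read
   one after the other, spell [0^r 1^r ... (n-1)^r]. *)
Lemma tableau_column (k : 'I_n) : (r <= n)%N ->
  exists t, forall i, t i = ((i * n + k) %/ r)%N :> nat.
Proof.
move=> rn; have lt (i : 'I_r) : ((i * n + k) %/ r < n)%N.
  have r0 : (0 < r)%N by case: i => i; lia.
  by rewrite ltn_divLR //; have := ltn_ord i; have := ltn_ord k; nia.
have [t tE] : {t : minrep r n | t =1 fun i => Ordinal (lt i)}.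
  apply: minrep_of => i j ij /=.
  have r0 : (0 < r)%N by case: i ij => i; lia.
  have : ((i * n + k + r) %/ r <= (j * n + k) %/ r)%N by apply: leq_div2r; nia.
  by rewrite divnDr // divnn r0 addn1.
by exists t => i; rewrite tE.
Qed.

(** Each value fills exactly [r] boxes of the tableau, so the product of the coordinates of its
    columns has torus weight [\det d ^+ r = 1]. The last column [v0] dominates the others, so no
    factor vanishes on the irreducible X(v0). Numbered from 1, (i n + n - 1) / r rounded down is
    ceil(i n / r). *)
Lemma semistable_point : (0 < r)%N -> (r <= n)%N -> exists v0 x,
  [/\ forall i, v0 i = ((i * n + n.-1) %/ r)%N :> nat, schubert K v0 x &
      forall w, brle v0 w -> semistable K w x].
Proof.
move=> r0 rn; have n0 : (0 < n)%N by apply: leq_trans rn.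
have [tau tauE] : exists tau : 'I_n -> minrep r n,
    forall k i, tau k i = ((i * n + k) %/ r)%N :> nat.
  exists (fun k => sval (cid (tableau_column k rn))) => k.
  exact: svalP (cid (tableau_column k rn)).
have klast : (n.-1 < n)%N by rewrite prednK.
pose v0 := tau (Ordinal klast).
have tauv k : brle (tau k) v0.
  apply/forallP => i; rewrite !tauE; apply: leq_div2r; rewrite leq_add2l /=.
  by rewrite -ltnS prednK.
pose f := \prod_(k < n) pcoord_poly K (tau k).
have fn : f \is n.-homog.
  suff : f \is (\sum_(k < n) 1)%N.-homog by rewrite sum1_card card_ord.
  by apply: dhomog_bigprod => k _; apply: dhomog_pcoord_poly.
have fE x : f.@[x 0] = \prod_(k < n) pcoord (tau k) x.
  by rewrite rmorph_prod; apply: eq_bigr => k _; rewrite -meval_pcoord_poly.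
have [x xv fx] : exists2 x, schubert K v0 x & f.@[x 0] != 0.
  apply: contrapT => nx.
  have : vanishes_on (schubert K v0) f.
    by move=> x xv; apply/eqP/negPn/negP => fx; apply: nx; exists x.
  move=> /(irreducible_prod (schubert_irreducible K v0) (fun k => dhomog_pcoord_poly K (tau k))).
  move=> [k /(_ _ (schubert_sub (tauv k) (schubert_cell_point K (tau k))))] /eqP.
  by rewrite meval_pcoord_poly pcoord_wedge det_mxsub1 eqxx oner_eq0.
exists v0, x; split => // [i|w vw]; first by rewrite tauE.
split; first exact: schubert_sub vw _ xv.
exists n, (fun x => f.@[x 0]); split => //; first exact: homogeneous_section.
move=> d y dT _; rewrite !fE.
under eq_bigr do rewrite (pcoord_torus _ _ dT).
rewrite big_split /= [X in X * _](_ : _ = 1) ?mul1r //.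
(* Diagonal entries indexed by naturals, so that the boxes can be regrouped from [r] rows of length
   [n] into [n] runs of [r] equal values. *)
pose h (p : nat) := d (insubd (Ordinal n0) p) (insubd (Ordinal n0) p).
transitivity (\prod_(i < r) \prod_(k < n) h ((i * n + k) %/ r)%N).
  rewrite exchange_big; apply: eq_bigr => i _; apply: eq_bigr => k _ /=.
  by rewrite -tauE /h valKd.
rewrite (prod_blocks r n (fun p => h (p %/ r)%N)) mulnC.
rewrite -(prod_blocks n r (fun p => h (p %/ r)%N)).
transitivity (\prod_(j < n) h j ^+ r).
  apply: eq_bigr => j _; rewrite -[in RHS](card_ord r) -prodr_const.
  by apply: eq_bigr => l _; rewrite divnMDl // divn_small // addn0.
rewrite prodrXl (_ : \prod_(j < n) h j = 1) ?expr1n //.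
apply: etrans (proj2 dT); rewrite det_trig; last by case: dT; rewrite is_diag_mxEtrig => /andP[].
by apply: eq_bigr => j _; rewrite /h valKd.
Qed.

Lemma semistable_restrict u w x : brle u w -> schubert K u x ->
  semistable K w x -> semistable K u x.
Proof.
move=> uw xu [xw [m [s [m0 sec inv sx]]]]; split => //; exists m, s; split => //.
  move=> y yu; have [d [f [g [fd gd gy sE]]]] := sec y (schubert_sub uw yu).
  by exists d, f, g; split => // z zu; apply: sE; apply: schubert_sub uw _ zu.
by move=> d y dT yu; apply: inv => //; apply: schubert_sub uw _ yu.
Qed.

(** Descent on the sum of the entries, which drops strictly along the Bruhat order. *)
Lemma minimal_semistable_below u : semistable K u !=set0 ->
  exists2 v, minimal_semistable K v & brle v u.
Proof.
have [m] := ubnP (\sum_i u i); elim: m u => // m IHm u lem u0.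
have [umin|] := pselect (minimal_semistable K u); first by exists u => //; apply: brle_refl.
move=> /not_andP[//|/existsNP[u' /not_implyP[/brleP u'u /not_implyP[u'0 /eqP nu]]]].
have [v vmin vu'] : exists2 v, minimal_semistable K v & brle v u'.
  apply: IHm => //; rewrite -ltnS; apply: leq_trans lem; rewrite ltnS.
  rewrite ltn_neqAle leq_sum ?andbT; last by move=> i _; apply/forallP: i.
  apply: contra nu => /eqP e; apply/eqP/minrep_eq => i.
  have le (k : 'I_r) : (u' k <= u k)%N by apply/forallP: k.
  have := eq_leq (esym e); rewrite (bigD1 i) //= [X in (_ <= X)%N](bigD1 i) //=.
  have : (\sum_(k < r | k != i) u' k <= \sum_(k < r | k != i) u k)%N by apply: leq_sum.
  move=> h1 h2; apply: val_inj => /=; apply/eqP; rewrite eqn_leq le /=.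
  by rewrite -(leq_add2r (\sum_(k < r | k != i) u k)); apply: leq_trans h2 _; rewrite leq_add2l.
by exists v => //; apply: brle_trans vu' u'u.
Qed.

Lemma minimal_semistable_le v u : unique (@minimal_semistable K r n) v ->
  semistable K u !=set0 -> brle v u.
Proof.
by move=> [_ vmin] /minimal_semistable_below[v' /vmin <-].
Qed.

Lemma semistable_smooth_iff v w : (0 < r)%N -> (r <= n)%N ->
  unique (@minimal_semistable K r n) v -> semistable K w !=set0 ->
  semistable K w `<=` smooth_locus (schubert K w) <->
  (forall i j : 'I_r, j = i.+1 :> nat -> ((w i).+1 < w j)%N -> (w i < v j)%N).
Proof.
move=> r0 rn hv hw; split=> [smooth i j ji wij|cond x xs].
  rewrite ltnNge; apply/negP => vjw.
  have [v0 [x [v0E xv0 xss]]] := semistable_point r0 rn.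
  have vw := minimal_semistable_le hv hw.
  (* [semistable_bound] reads [n * k.+1 <= r * (v k).+1]; rounding down after division by [r] gives
     [v0 k <= v k]. *)
  have v0v : brle v0 v.
    apply/forallP => k; rewrite v0E -ltnS ltn_divLR //.
    have := semistable_bound k hv.1.1; lia.
  (* The cell of [x] may lie strictly below [v0]; from u <= v0 <= v one still gets
     [u j <= v j <= w i], which produces too many tangent directions. *)
  have [u [uv0 ux _]] := schubert_sub_cells xv0.
  have uv := brle_trans uv0 v0v; have uw := brle_trans uv vw.
  have /(smooth_cell uw ux) e := smooth x (xss w (brle_trans v0v vw)).
  have := @card_exchanges_gt _ _ u w i j uw ji wij.
  rewrite e ltnn => /(_ (leq_trans (forallP uv j) vjw)).
  by [].
have [u [uw ux _]] := schubert_sub_cells xs.1.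
have vu : brle v u.
  apply: (minimal_semistable_le hv); exists x.
  exact: semistable_restrict uw (cell_sub_schubert ux) xs.
apply/(smooth_cell uw ux)/card_exchanges_eq => // i j ji wij.
exact: leq_trans (cond i j ji wij) (forallP vu j).
Qed.

End Semistability.

Theorem proposition3p4 (R : realType) (n r : nat)
    (hr : (2 <= r)%N) (hrn : (r <= n - 2)%N) (v w : minrep r n)
    (hv : unique (minimal_semistable R[i]) v)
    (hw : semistable R[i] w !=set0) :
  semistable R[i] w `<=` smooth_locus (schubert R[i] w) <->
  (forall i j : 'I_r, j = i.+1 :> nat ->
     ((w i).+1 < w j)%N -> (w i < v j)%N).
Proof. by apply: semistable_smooth_iff hv hw; lia. Qed.
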